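(* Let $\phi(x)=\frac{ax+b}{cx+d}$ with $a,b,c,d\in\mathbb{Q}_2$, $ad-bc\ne0$, let $\Delta=(d-a)^2+4bc$ and assume $\sqrt{\Delta}\notin\mathbb{Q}_2$. Let $K=\mathbb{Q}_2(\sqrt{\Delta})$ and suppose that $\lambda=\frac{a+d+\sqrt{\Delta}}{a+d-\sqrt{\Delta}}\in K$ is not a root of unity. Let $\ell$ be the order of (the reduction of) $\lambda$ in the multiplicative group $\mathbb{K}^*$ of the residue field $\mathbb{K}$ of $K$. Assume $K=\mathbb{Q}_2(\sqrt{-3})$. Then the dynamical system $(\mathbb{P}^1(\mathbb{Q}_2),\phi)$ is decomposed into $$\frac{3\cdot 2^{\,v_2(\lambda^{2\ell}-1)-2}}{\ell}$$ minimal subsystems. Moreover, each minimal subsystem is topologically conjugate to the adding machine on the odometer $\mathbb{Z}_{(p_s)}$ with $(p_s)=(\ell,\ell\cdot 2,\ell\cdot 2^2,\cdots)$.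
   Context: $\mathbb{P}^1(\mathbb{Q}_2)=\mathbb{Q}_2\cup\{\infty\}$ with its usual compact topology. $|\cdot|_2$ and $v_2=-\log_2|\cdot|_2$ are extended to $K$; one has $|\lambda|_2=1$. A subsystem is a pair $(E,\phi)$ with $E$ compact and $\phi(E)\subset E$; it is minimal if $E=\overline{\{\phi^n(x):n\ge 0\}}$ for every $x\in E$. ''Decomposed into $M$ minimal subsystems'' means that $\mathbb{P}^1(\mathbb{Q}_2)$ is the disjoint union of $M$ nonempty compact $\phi$-invariant sets, on each of which $\phi$ is minimal. For positive integers $p_s\mid p_{s+1}$ $(s\ge1)$, the odometer $\mathbb{Z}_{(p_s)}$ is the inverse limit of $\mathbb{Z}/p_s\mathbb{Z}$, and the adding machine is $x\mapsto x+1$ on it. *)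

(* Defs.v *)
From HB Require Import structures.
From mathcomp Require Import all_boot all_order all_algebra all_field.
From mathcomp Require Import zify ring.
From mathcomp Require Import all_classical all_reals all_analysis.

Set Implicit Arguments.
Unset Strict Implicit.
Unset Printing Implicit Defensive.

Import Order.TTheory GRing.Theory Num.Theory.
Local Open Scope classical_set_scope.
Local Open Scope ring_scope.

(* The inverse limit of the Z/p_s, as a subset of the product over s of the
   sets of residues. *)
Definition odometer (p : nat -> nat) : set (prod_topology (fun _ : nat => nat)) :=
  [set x | forall s, (x s < p s)%N /\ (x s.+1 %% p s)%N = x s].

Definition adding_machine (p : nat -> nat)
    (x : prod_topology (fun _ : nat => nat)) : prod_topology (fun _ : nat => nat) :=
  fun s => ((x s).+1 %% p s)%N.

Lemma odometer_adding (p : nat -> nat) x :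
    (forall s, 0 < p s)%N -> (forall s, p s %| p s.+1)%N ->
  odometer p x -> odometer p (adding_machine p x).
Proof.
move=> p0 pd ox s; have [xs xS] := ox s; split; first by rewrite ltn_mod.
rewrite /adding_machine modn_dvdm ?pd// -addn1 -modnDml xS addn1.
by [].
Qed.

(* The ring of 2-adic integers, i.e. the inverse limit of the Z/2^s. *)
Record Z2 := MkZ2 { z2 : nat -> nat; z2P : z2 \in odometer (expn 2) }.
HB.instance Definition _ := [isSub for z2].
HB.instance Definition _ := [Choice of Z2 by <:].

Section Z2Ring.
Implicit Types x y z : Z2.

Lemma z2_lt x s : (z2 x s < 2 ^ s)%N.
Proof. by have := z2P x; rewrite inE => /(_ s)[]. Qed.

Lemma z2_mod x s t : (s <= t)%N -> (z2 x t %% 2 ^ s)%N = z2 x s.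
Proof.
move=> /subnK <-; elim: (t - s)%N => [|k IH].
  by rewrite add0n modn_small ?z2_lt.
have := z2P x; rewrite inE => /(_ (k + s)%N)[_ e].
rewrite -IH addSn -e modn_dvdm// dvdn_exp2l//.
by rewrite leq_addl.
Qed.

Lemma z2_ext x y : (forall s, z2 x s = z2 y s) -> x = y.
Proof. by move=> e; apply/val_inj/funext. Qed.

Lemma z2_subproof (f : nat -> nat) :
    (forall s, f s.+1 = f s %[mod 2 ^ s]) ->
  (fun s => f s %% 2 ^ s)%N \in odometer (expn 2).
Proof.
move=> e; rewrite inE => s /=; split; first by rewrite ltn_mod expn_gt0.
by rewrite modn_dvdm ?e// dvdn_exp2l.
Qed.

Definition mkZ2 f (e : forall s, f s.+1 = f s %[mod 2 ^ s]) : Z2 :=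
  MkZ2 (z2_subproof e).

Lemma z2_modS x s : z2 x s.+1 = z2 x s %[mod 2 ^ s].
Proof. by rewrite !z2_mod. Qed.

Lemma Z2_natP n (s : nat) : n = n %[mod 2 ^ s]. Proof. by []. Qed.
Definition Z2_nat n : Z2 := mkZ2 (Z2_natP n).

Lemma Z2_addP x y s :
  (z2 x s.+1 + z2 y s.+1 = z2 x s + z2 y s %[mod 2 ^ s])%N.
Proof. by rewrite -modnDm !z2_modS modnDm. Qed.
Definition Z2_add x y : Z2 := mkZ2 (Z2_addP x y).

Lemma Z2_mulP x y s :
  (z2 x s.+1 * z2 y s.+1 = z2 x s * z2 y s %[mod 2 ^ s])%N.
Proof. by rewrite -modnMm !z2_modS modnMm. Qed.
Definition Z2_mul x y : Z2 := mkZ2 (Z2_mulP x y).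

Lemma Z2_oppP x s : (2 ^ s.+1 - z2 x s.+1 = 2 ^ s - z2 x s %[mod 2 ^ s])%N.
Proof.
apply/eqP; rewrite -(eqn_modDr (z2 x s.+1)) subnK ?(ltnW (z2_lt _ _))//.
rewrite -modnDmr z2_modS modnDmr subnK ?(ltnW (z2_lt _ _))//.
by rewrite expnS mulnC modnMr modnn.
Qed.
Definition Z2_opp x : Z2 := mkZ2 (Z2_oppP x).

Lemma z2E_add x y s : z2 (Z2_add x y) s = ((z2 x s + z2 y s) %% 2 ^ s)%N.
Proof. by []. Qed.
Lemma z2E_mul x y s : z2 (Z2_mul x y) s = ((z2 x s * z2 y s) %% 2 ^ s)%N.
Proof. by []. Qed.
Lemma z2E_opp x s : z2 (Z2_opp x) s = ((2 ^ s - z2 x s) %% 2 ^ s)%N.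
Proof. by []. Qed.
Lemma z2E_nat n s : z2 (Z2_nat n) s = (n %% 2 ^ s)%N.
Proof. by []. Qed.

Lemma Z2_addA : associative Z2_add.
Proof.
by move=> x y z; apply: z2_ext => s; rewrite !z2E_add modnDml modnDmr addnA.
Qed.
Lemma Z2_addC : commutative Z2_add.
Proof. by move=> x y; apply: z2_ext => s; rewrite !z2E_add addnC. Qed.
Lemma Z2_add0 : left_id (Z2_nat 0) Z2_add.
Proof.
by move=> x; apply: z2_ext => s; rewrite z2E_add z2E_nat mod0n z2_mod.
Qed.
Lemma Z2_addN : left_inverse (Z2_nat 0) Z2_opp Z2_add.
Proof.
move=> x; apply: z2_ext => s; rewrite z2E_add z2E_opp z2E_nat modnDml.
by rewrite subnK ?modnn ?mod0n// ltnW ?z2_lt.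
Qed.
HB.instance Definition _ :=
  GRing.isZmodule.Build Z2 Z2_addA Z2_addC Z2_add0 Z2_addN.

Lemma Z2_mulA : associative Z2_mul.
Proof.
by move=> x y z; apply: z2_ext => s; rewrite !z2E_mul modnMml modnMmr mulnA.
Qed.
Lemma Z2_mulC : commutative Z2_mul.
Proof. by move=> x y; apply: z2_ext => s; rewrite !z2E_mul mulnC. Qed.
Lemma Z2_mul1 : left_id (Z2_nat 1) Z2_mul.
Proof.
by move=> x; apply: z2_ext => s; rewrite z2E_mul z2E_nat modnMml mul1n z2_mod.
Qed.
Lemma Z2_mulD : left_distributive Z2_mul +%R.
Proof.
move=> x y z; apply: z2_ext => s; rewrite -[_ + _]/(Z2_add _ _).
rewrite -[RHS]/(z2 (Z2_add _ _) _) !z2E_mul !z2E_add !z2E_mul.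
by rewrite modnMml modnDm mulnDl.
Qed.
Lemma Z2_1neq0 : Z2_nat 1 != 0.
Proof. by apply/eqP => /(congr1 (fun x => z2 x 1)). Qed.
HB.instance Definition _ :=
  GRing.Zmodule_isComNzRing.Build Z2 Z2_mulA Z2_mulC Z2_mul1 Z2_mulD Z2_1neq0.

End Z2Ring.

Section Z2Order.
Implicit Types x y : Z2.

Lemma z2D x y s : z2 (x + y) s = ((z2 x s + z2 y s) %% 2 ^ s)%N.
Proof. by []. Qed.
Lemma z2M x y s : z2 (x * y) s = ((z2 x s * z2 y s) %% 2 ^ s)%N.
Proof. by []. Qed.
Lemma z2_0 s : z2 0 s = 0%N. Proof. exact: mod0n. Qed.

Lemma z2_exp0 x : z2 x 0 = 0%N.
Proof. by have := z2_lt x 0; case: (z2 x 0). Qed.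

Lemma z2_0S x s t : (s <= t)%N -> z2 x t = 0%N -> z2 x s = 0%N.
Proof. by move=> st xt; rewrite -(z2_mod x st) xt mod0n. Qed.

(* The exponent of the largest power of 2 dividing x; it is 0 for x = 0. *)
Definition ord2 x : nat := xget 0%N [set n | z2 x n = 0%N /\ z2 x n.+1 <> 0%N].

Lemma ord2_eq x n : z2 x n = 0%N -> z2 x n.+1 <> 0%N -> ord2 x = n.
Proof.
move=> xn xn1; rewrite /ord2; case: xgetP => [m _ [xm xm1]|/(_ n)[]//].
case: (ltngtP m n) => // lt.
  by have := z2_0S lt xn.
by have := z2_0S lt xm.
Qed.

Lemma ord2P x : x != 0 -> z2 x (ord2 x) = 0%N /\ z2 x (ord2 x).+1 <> 0%N.
Proof.
move=> x0; have [n xn] : exists n, z2 x n != 0%N.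
  apply: contrapT => /forallNP xn; case/eqP: x0; apply: z2_ext => s.
  by rewrite z2_0; apply/eqP; have /negP := xn s; rewrite negbK.
have exx : exists n, z2 x n != 0%N by exists n.
case: (ex_minnP exx) => -[|m] xm mmin; first by rewrite z2_exp0 in xm.
have xm0 : z2 x m = 0%N.
  by apply/eqP; apply: contraT => /mmin; rewrite ltnn.
by move/eqP in xm; rewrite (ord2_eq xm0 xm).
Qed.

Lemma z2_ord x s : x != 0 -> (ord2 x < s)%N ->
  exists k, z2 x s = (2 ^ ord2 x * k.*2.+1)%N.
Proof.
move=> x0 xs; have [x1 x2] := ord2P x0.
have /dvdnP[q e] : (2 ^ ord2 x %| z2 x s)%N.
  by rewrite /dvdn z2_mod ?x1// ltnW.
have [oq|eq] := boolP (odd q).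
  by exists q./2; rewrite e mulnC -[in LHS](odd_double_half q) oq.
case: x2; rewrite -(z2_mod x xs); apply/eqP.
rewrite -[(_ == _)]/(2 ^ _ %| _)%N e expnS dvdn_pmul2r ?expn_gt0//.
by rewrite dvdn2.
Qed.

Lemma z2M_ord x y : x != 0 -> y != 0 ->
  z2 (x * y) (ord2 x + ord2 y) = 0%N /\ z2 (x * y) (ord2 x + ord2 y).+1 <> 0%N.
Proof.
move=> x0 y0; set n := (ord2 x + ord2 y)%N.
have [j xj] := @z2_ord x n.+1 x0 ltac:(by rewrite ltnS leq_addr).
have [k yk] := @z2_ord y n.+1 y0 ltac:(by rewrite ltnS leq_addl).
have e : (z2 x n.+1 * z2 y n.+1 = 2 ^ n * (j.*2.+1 * k.*2.+1))%N.
  by rewrite xj yk mulnACA -expnD.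
split.
  rewrite -(z2_mod _ (leqnSn n)) z2M modn_dvdm ?dvdn_exp2l// e.
  by rewrite modnMr.
rewrite z2M e => /eqP; rewrite -[(_ == _)]/(2 ^ _ %| _)%N expnSr.
by rewrite dvdn_pmul2l ?expn_gt0// dvdn2 oddM /= !odd_double.
Qed.

Lemma Z2_idom (x y : Z2) : x * y = 0 -> (x == 0) || (y == 0).
Proof.
move=> xy0; apply: contraT; rewrite negb_or => /andP[x0 y0].
by have [_ []] := z2M_ord x0 y0; rewrite xy0 z2_0.
Qed.

Lemma ord2M x y : x != 0 -> y != 0 -> ord2 (x * y) = (ord2 x + ord2 y)%N.
Proof. by move=> x0 y0; apply: ord2_eq; have [] := z2M_ord x0 y0. Qed.

Lemma ord2D x y : x != 0 -> y != 0 -> x + y != 0 ->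
  (minn (ord2 x) (ord2 y) <= ord2 (x + y)%R)%N.
Proof.
move=> x0 y0 xy0; rewrite leqNgt; apply/negP => lt.
have [_] := ord2P xy0; apply; rewrite z2D.
move: lt; rewrite leq_min => /andP[ltx lty].
rewrite (z2_0S ltx (proj1 (ord2P x0))) (z2_0S lty (proj1 (ord2P y0))).
exact: mod0n.
Qed.

Definition Z2_unit : {pred Z2} := [pred x | `[< exists y, y * x = 1 >]].
Definition Z2_inv x : Z2 := if x \in Z2_unit then xget 0 [set y | y * x = 1] else x.

Lemma Z2_mulV : {in Z2_unit, left_inverse 1 Z2_inv *%R}.
Proof.
move=> x xu; rewrite /Z2_inv xu; case: xgetP => [y _ //|nx].
by have /asboolP[y /nx] := xu.
Qed.
Lemma Z2_unitP x y : y * x = 1 -> Z2_unit x.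
Proof. by move=> yx; apply/asboolP; exists y. Qed.
Lemma Z2_inv_out : {in [predC Z2_unit], Z2_inv =1 id}.
Proof. by move=> x; rewrite inE /Z2_inv => /negbTE ->. Qed.

HB.instance Definition _ :=
  GRing.ComNzRing_hasMulInverse.Build Z2 Z2_mulV Z2_unitP Z2_inv_out.
HB.instance Definition _ := GRing.ComUnitRing_isIntegral.Build Z2 Z2_idom.

End Z2Order.

(* Non-archimedean absolute values. *)
Record absolute_value (R : realFieldType) (F : fieldType) := AbsoluteValue {
  absval :> F -> R;
  absval_ge0 : forall x, 0 <= absval x;
  absval_eq0 : forall x, (absval x == 0) = (x == 0);
  absvalM : forall x y, absval (x * y) = absval x * absval y;
  absval_ultra : forall x y, absval (x + y) <= Num.max (absval x) (absval y)
}.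
Arguments absval : simpl never.

Definition Q2 := {fraction Z2}.
HB.instance Definition _ := GRing.Field.on Q2.

Section Abs2.
Variable R : realFieldType.

Definition absZ2 (x : Z2) : R := if x == 0 then 0 else 2 ^- ord2 x.

Lemma absZ2_ge0 x : 0 <= absZ2 x.
Proof. by rewrite /absZ2; case: ifP => // _; rewrite invr_ge0 exprn_ge0. Qed.

Lemma absZ2_eq0 x : (absZ2 x == 0) = (x == 0).
Proof.
by rewrite /absZ2; case: ifP; rewrite ?eqxx// invr_eq0 expf_eq0/= pnatr_eq0 andbF.
Qed.

Lemma absZ2M x y : absZ2 (x * y) = absZ2 x * absZ2 y.
Proof.
rewrite /absZ2 mulf_eq0; have [|x0] := eqVneq x; first by rewrite mul0r.
have [|y0] := eqVneq y; first by rewrite mulr0.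
by rewrite /= ord2M// exprD invfM.
Qed.

Lemma absZ2D x y : absZ2 (x + y) <= Num.max (absZ2 x) (absZ2 y).
Proof.
have [->|x0] := eqVneq x 0; first by rewrite add0r le_max lexx orbT.
have [->|y0] := eqVneq y 0; first by rewrite addr0 le_max lexx.
have [xy0|xy0] := eqVneq (x + y) 0.
  by rewrite {1}/absZ2 xy0 eqxx le_max absZ2_ge0.
rewrite /absZ2 (negbTE x0) (negbTE y0) (negbTE xy0) le_max.
have := ord2D x0 y0 xy0; rewrite geq_min => /orP[] le; apply/orP; [left|right];
  by rewrite lef_pV2 ?posrE ?exprn_gt0// ler_eXn2l// ltr1n.
Qed.

(* |n/d| = |n| / |d|, independently of the representative (see abs2_frac). *)
Definition abs2_fun (x : Q2) : R := absZ2 (repr x).1 / absZ2 (repr x).2.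

Lemma Q2_numden (x : Q2) : x * tofrac (repr x).2 = tofrac (repr x).1.
Proof.
rewrite -[x in LHS]reprK; set r := repr x.
rewrite /tofrac; unlock FracField.tofrac.
rewrite -[LHS]FracField.pi_mul; apply/eqmodP; rewrite /= FracField.equivfE.
rewrite /FracField.mulf !numden_Ratio ?mulf_neq0 ?oner_neq0 ?denom_ratioP//.
by rewrite !mulr1 reprK mulrC.
Qed.

Lemma abs2_frac (x : Q2) n d :
  d != 0 -> x * tofrac d = tofrac n -> abs2_fun x = absZ2 n / absZ2 d.
Proof.
move=> d0 e; rewrite /abs2_fun.
have r0 : (repr x).2 != 0 := denom_ratioP _.
apply/eqP; rewrite eqr_div ?absZ2_eq0// -!absZ2M; apply/eqP; congr absZ2.
apply/eqP; rewrite -tofrac_eq !rmorphM/= -Q2_numden -e; apply/eqP; ring.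
Qed.

Lemma Q2_numdenE (x : Q2) :
  exists n d : Z2, [/\ d != 0, x * tofrac d = tofrac n &
                      abs2_fun x = absZ2 n / absZ2 d].
Proof.
exists (repr x).1, (repr x).2; split => //; first exact: denom_ratioP.
exact: Q2_numden.
Qed.

Lemma abs2_ge0 x : 0 <= abs2_fun x.
Proof. by rewrite divr_ge0 ?absZ2_ge0. Qed.

Lemma abs2_eq0 x : (abs2_fun x == 0) = (x == 0).
Proof.
have [n [d [d0 e ->]]] := Q2_numdenE x.
rewrite mulf_eq0 invr_eq0 !absZ2_eq0 (negbTE d0) orbF.
rewrite -tofrac_eq0 -e mulf_eq0 tofrac_eq0 (negbTE d0) orbF//.
Qed.

Lemma abs2M x y : abs2_fun (x * y) = abs2_fun x * abs2_fun y.
Proof.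
have [n [d [d0 e ->]]] := Q2_numdenE x.
have [m [c [c0 f ->]]] := Q2_numdenE y.
rewrite mulf_div -!absZ2M; apply: abs2_frac; first by rewrite mulf_neq0.
by rewrite !rmorphM/= -e -f; ring.
Qed.

Lemma abs2_ultra x y :
  abs2_fun (x + y) <= Num.max (abs2_fun x) (abs2_fun y).
Proof.
have [n [d [d0 e ->]]] := Q2_numdenE x.
have [m [c [c0 f ->]]] := Q2_numdenE y.
have dc0 : d * c != 0 by rewrite mulf_neq0.
rewrite (@abs2_frac _ (n * c + m * d) (d * c))//; last first.
  by rewrite rmorphD !rmorphM/= -e -f; ring.
have -> : absZ2 n / absZ2 d = absZ2 (n * c) / absZ2 (d * c).
  by rewrite !absZ2M -mulf_div divff ?absZ2_eq0// mulr1.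
have -> : absZ2 m / absZ2 c = absZ2 (m * d) / absZ2 (d * c).
  by rewrite [d * c]mulrC !absZ2M -mulf_div divff ?absZ2_eq0// mulr1.
rewrite -maxr_pMl ?invr_ge0 ?absZ2_ge0// ler_wpM2r ?invr_ge0 ?absZ2_ge0//.
exact: absZ2D.
Qed.

Definition abs2 : absolute_value R Q2 :=
  AbsoluteValue abs2_ge0 abs2_eq0 abs2M abs2_ultra.

End Abs2.

Section AbsoluteValueTheory.
Variables (R : realFieldType) (F : fieldType) (v : absolute_value R F).

Lemma absval0 : v 0 = 0. Proof. by apply/eqP; rewrite absval_eq0. Qed.

Lemma absval1 : v 1 = 1.
Proof.
have v1 : v 1 != 0 by rewrite absval_eq0 oner_neq0.
by apply: (mulfI v1); rewrite -absvalM !mulr1.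
Qed.

Lemma absvalN x : v (- x) = v x.
Proof.
rewrite -mulN1r absvalM; suff -> : v (-1) = 1 by rewrite mul1r.
apply/eqP; rewrite -(eqrXn2 (n := 2)) ?absval_ge0 ?ler01// expr1n expr2.
by rewrite -absvalM mulrNN mulr1 absval1.
Qed.

Lemma absvalV x : v x^-1 = (v x)^-1.
Proof.
have [->|x0] := eqVneq x 0; first by rewrite invr0 absval0 invr0.
have vx : v x != 0 by rewrite absval_eq0.
by apply: (mulfI vx); rewrite -absvalM !divff// absval1.
Qed.

Lemma absval_ultraB x y : v (x - y) <= Num.max (v x) (v y).
Proof. by rewrite -(absvalN y) absval_ultra. Qed.

Definition vr_pred : {pred F} := [pred x | v x <= 1].

Lemma vr_pred_subring : subring_closed vr_pred.
Proof.
split=> [|x y|x y]; rewrite !inE ?absval1// => x1 y1.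
  by rewrite (le_trans (absval_ultraB _ _))// ge_max x1.
by rewrite absvalM mulr_ile1 ?absval_ge0.
Qed.
HB.instance Definition _ := GRing.isSubringClosed.Build F vr_pred vr_pred_subring.

Record valuation_ring := ValuationRing { vr_val : F; vr_valP : vr_val \in vr_pred }.
HB.instance Definition _ := [isSub for vr_val].
HB.instance Definition _ := [Choice of valuation_ring by <:].
HB.instance Definition _ := [SubChoice_isSubComNzRing of valuation_ring by <:].

Definition maximal_ideal : {pred valuation_ring} := [pred x | v (val x) < 1].

Lemma maximal_ideal_closed : idealr_closed maximal_ideal.
Proof.
split=> [||a x y]; rewrite !inE ?rmorph0 ?rmorph1 ?absval0 ?absval1 ?ltr01 ?ltxx//.
move=> x1 y1; rewrite rmorphD rmorphM /= (le_lt_trans (absval_ultra _ _ _))//.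
rewrite gt_max y1 andbT absvalM (le_lt_trans _ x1)// ler_piMl ?absval_ge0//.
exact: (vr_valP a).
Qed.
HB.instance Definition _ :=
  isIdealr.Build valuation_ring maximal_ideal maximal_ideal_closed.

Definition residue_field := {ideal_quot maximal_ideal}.
HB.instance Definition _ := GRing.ComNzRing.on residue_field.

(* Meaningful for v x <= 1 only; the reduction is 0 otherwise. *)
Definition reduction (x : F) : residue_field :=
  \pi_residue_field%qT (insubd (0 : valuation_ring) x).

Lemma residue_fieldV (x : residue_field) : x != 0 -> exists y, y * x = 1.
Proof.
elim/quotW: x => r r0.
have vr : v (val r) = 1.
  apply/le_anti; rewrite [v _ <= 1](vr_valP r) leNgt/=; apply: contra r0 => r1.
  by rewrite -(rmorph0 \pi_residue_field%qT) -Quotient.idealrBE subr0.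
have ri : (val r)^-1 \in vr_pred by rewrite inE absvalV vr invr1.
exists (\pi_residue_field%qT (ValuationRing ri)); rewrite -rmorphM.
rewrite -(rmorph1 \pi_residue_field%qT); congr (\pi%qT); apply/val_inj => /=.
by rewrite mulVf// -(absval_eq0 v) vr oner_neq0.
Qed.

End AbsoluteValueTheory.

Section Q2Topology.

Definition Q2_ball (x : Q2) (e : rat) : set Q2 := [set y | abs2 rat (x - y) < e].

Lemma Q2_ball_center x (e : rat) : 0 < e -> Q2_ball x e x.
Proof. by rewrite /Q2_ball/= subrr absval0. Qed.

Lemma Q2_ball_sym x y (e : rat) : Q2_ball x e y -> Q2_ball y e x.
Proof. by rewrite /Q2_ball/= -absvalN opprB. Qed.

Lemma Q2_ball_triangle x y z (e1 e2 : rat) :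
  Q2_ball x e1 y -> Q2_ball y e2 z -> Q2_ball x (e1 + e2) z.
Proof.
rewrite /Q2_ball/= => xy yz; rewrite -(subrKA y).
apply: (le_lt_trans (absval_ultra _ _ _)); rewrite gt_max.
have e1_ge0 : 0 <= e1 := ltW (le_lt_trans (absval_ge0 _ _) xy).
have e2_ge0 : 0 <= e2 := ltW (le_lt_trans (absval_ge0 _ _) yz).
by rewrite ltr_wpDr// ltr_wpDl.
Qed.

HB.instance Definition _ := hasNbhs.Build Q2 (nbhs_ (entourage_ Q2_ball)).
HB.instance Definition _ := Nbhs_isPseudoMetric.Build rat Q2 erefl
  Q2_ball_center Q2_ball_sym Q2_ball_triangle erefl.

End Q2Topology.

Definition P1Q2 := one_point_compactification Q2.

Definition mobius (a b c d : Q2) (z : P1Q2) : P1Q2 :=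
  match z with
  | Some x => if c * x + d == 0 then None else Some ((a * x + b) / (c * x + d))
  | None => if c == 0 then None else Some (a / c)
  end.

(* At x = 0, where the valuation is infinite, the value is a meaningless 0. *)
Definition v2 (R : realType) (F : fieldType) (v : absolute_value R F) (x : F) : R :=
  - (ln (v x) / ln 2).

Section Dynamics.
Variables (T : topologicalType) (f : T -> T).

Definition subsystem (E : set T) := compact E /\ f @` E `<=` E.

Definition minimal_subsystem (E : set T) :=
  subsystem E /\
  forall x, E x -> E = closure [set iter n f x | n in [set: nat]].

Definition decomposed_into_minimal (M : nat) :=
  exists E : 'I_M -> set T,
    [/\ forall i, E i !=set0, forall i, minimal_subsystem (E i),
        trivIset setT E & \bigcup_i E i = setT].

End Dynamics.

(* (E, f) and (F, g) are topologically conjugate; h and k are mutually inverse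
   homeomorphisms between E and F, their values off E and F being irrelevant. *)
Definition topologically_conjugate (T U : topologicalType)
    (f : T -> T) (E : set T) (g : U -> U) (F : set U) :=
  exists (h : T -> U) (k : U -> T),
    [/\ {within E, continuous h} /\ {within F, continuous k},
        h @` E `<=` F, k @` F `<=` E,
        (forall x, E x -> k (h x) = x) /\ (forall y, F y -> h (k y) = y)
      & forall x, E x -> h (f x) = g (h x)].

(* Main.v *)
(** In the affine coordinate [Y = (c/y) x + (d - a)/(2y) + 1/2], where
    [sqrtD = y * sqrt (-3)], the map acts on a point with primitive Z_2-coordinates
    [(n, d)], read as the Eisenstein integer [n + d w], up to scalars as multiplication by a unit
    [m] of Z_2[w], and [lambda = m / conj m].  Two points are congruent modulo [2^k]
    when [2^k] divides the cross product of their coordinates; as the cross product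
    of [p] and [m^n p] is the [w]-coordinate [v_n] of [m^n] times a unit, and
    [|v_n| = |lambda^n - 1|], every point is [2^k]-close to its n-th iterate exactly
    when [2^k] divides [lambda^n - 1].  The valuation of [v_n] at [n = ell 2^s] grows
    by one with [s] as soon as [s >= 1], and a class modulo [2^k] splits into two;
    hence an orbit is dense in the union of the classes modulo
    [2^(v(lambda^(2 ell) - 1))] it meets.  There are [3 2^(k-1)] classes modulo
    [2^k], permuted in cycles of length [2 ell] at that level. *)
Require Import Defs.
From mathcomp Require Import all_boot all_order all_algebra all_field.
From mathcomp Require Import zify ring.
From mathcomp Require Import all_classical all_reals all_analysis.

Set Implicit Arguments.
Unset Strict Implicit.
Unset Printing Implicit Defensive.

Import Order.TTheory GRing.Theory Num.Theory.
Local Open Scope classical_set_scope.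
Local Open Scope ring_scope.

(** * Divisibility by powers of 2 in Z_2 *)

(** Divisibility by [2^k], read off the residue modulo [2^k] and hence boolean. *)
Definition dvd2 k (x : Z2) : bool := z2 x k == 0%N.

Section Divisibility.
Implicit Types (x y : Z2) (k : nat).

Lemma dvd2_0r k : dvd2 k 0. Proof. by rewrite /dvd2 z2_0. Qed.
Lemma dvd2_0l x : dvd2 0 x. Proof. by rewrite /dvd2 z2_exp0. Qed.

Lemma dvd2_le j k x : (j <= k)%N -> dvd2 k x -> dvd2 j x.
Proof. by move=> jk /eqP /(z2_0S jk) /eqP. Qed.

Lemma dvd2_ord k x : x != 0 -> dvd2 k x = (k <= ord2 x)%N.
Proof.
move=> /ord2P[x0 x1]; apply/idP/idP => [kx|le]; last first.
  by apply: (dvd2_le le); apply/eqP.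
by rewrite leqNgt; apply/negP => /dvd2_le /(_ kx) /eqP.
Qed.

Lemma dvd2D k x y : dvd2 k x -> dvd2 k y -> dvd2 k (x + y).
Proof. by move=> /eqP x0 /eqP y0; rewrite /dvd2 z2D x0 y0 mod0n. Qed.

Lemma dvd2Ml k x y : dvd2 k x -> dvd2 k (x * y).
Proof. by move=> /eqP x0; rewrite /dvd2 z2M x0 mul0n mod0n. Qed.

Lemma dvd2Mr k x y : dvd2 k y -> dvd2 k (x * y).
Proof. by rewrite mulrC; apply: dvd2Ml. Qed.

Lemma dvd2N k x : dvd2 k (- x) = dvd2 k x.
Proof.
by apply/idP/idP => h; rewrite -[x]opprK -mulN1r; apply: dvd2Mr; rewrite // opprK.
Qed.

Lemma dvd2B k x y : dvd2 k x -> dvd2 k y -> dvd2 k (x - y).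
Proof. by move=> kx ky; rewrite dvd2D// dvd2N. Qed.

Lemma dvd2_sub k x y : z2 x k = z2 y k -> dvd2 k (x - y).
Proof. by move=> e; rewrite /dvd2 z2D e -z2D subrr z2_0. Qed.

(** Modulo [2^(k+1)] a multiple of [2^k] is 0 or [2^k], and two such residues cancel exactly when
    they agree. *)
Lemma dvd2DSE k x y : dvd2 k x -> dvd2 k y ->
  dvd2 k.+1 (x + y) = (dvd2 k.+1 x == dvd2 k.+1 y).
Proof.
have digit z : dvd2 k z -> z2 z k.+1 = if dvd2 k.+1 z then 0%N else (2 ^ k)%N.
  rewrite /dvd2 -(z2_mod z (leqnSn k)) => /dvdnP[q zq].
  have := z2_lt z k.+1; rewrite zq expnS ltn_pmul2r ?expn_gt0// muln_eq0 expn_eq0/=.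
  by case: q {zq} => [|[|]]//; rewrite mul1n orbF.
move=> /digit xk /digit yk; rewrite {1}/dvd2 z2D xk yk.
case: ifP => _; case: ifP => _; rewrite ?mod0n ?addn0 ?add0n ?addnn -?mul2n -?expnS ?modnn//.
  by rewrite modn_small ?expn_eq0// ltn_exp2l.
by rewrite modn_small ?expn_eq0// ltn_exp2l.
Qed.

Lemma dvd2_1D x y : dvd2 1 (x + y) = (dvd2 1 x == dvd2 1 y).
Proof. by rewrite dvd2DSE ?dvd2_0l. Qed.

Lemma dvd2_oddMl k x y : ~~ dvd2 1 x -> dvd2 k (x * y) = dvd2 k y.
Proof.
move=> ox; have x0 : x != 0 by apply: contraNneq ox => ->; exact: dvd2_0r.
have [->|y0] := eqVneq y 0; first by rewrite mulr0.
move: ox; rewrite !dvd2_ord ?mulf_neq0// ord2M//.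
by case: (ord2 x).
Qed.

Lemma dvd2_1M x y : dvd2 1 (x * y) = dvd2 1 x || dvd2 1 y.
Proof.
by have [/dvd2Ml->//|/dvd2_oddMl->] := boolP (dvd2 1 x).
Qed.

Lemma ord2_2 : ord2 2 = 1%N. Proof. by apply: ord2_eq. Qed.

Lemma Z2_2_neq0 : 2 != 0 :> Z2.
Proof. by apply/eqP => /(congr1 (fun x => z2 x 2)). Qed.

Lemma dvd2_2M k x : dvd2 k.+1 (2 * x) = dvd2 k x.
Proof.
have [->|x0] := eqVneq x 0; first by rewrite mulr0 !dvd2_0r.
by rewrite !dvd2_ord ?mulf_neq0 ?Z2_2_neq0// ord2M ?Z2_2_neq0// ord2_2.
Qed.

Lemma dvd2_exp k : dvd2 k (2 ^+ k) && ~~ dvd2 k.+1 (2 ^+ k).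
Proof.
by elim: k => // k IH; rewrite !exprS !dvd2_2M.
Qed.

Lemma Z2_half x : dvd2 1 x -> exists y, x = 2 * y.
Proof.
move=> x1.
have ev s : ~~ odd (z2 x s.+1).
  by move: x1; rewrite /dvd2 -(@z2_mod x 1 s.+1)// modn2; case: odd.
(* Halving loses one binary digit, so the residue of the half modulo [2^s] comes from that of [x]
   modulo [2^(s+1)]. *)
have P s : (z2 x s.+2)./2 = (z2 x s.+1)./2 %[mod 2 ^ s].
  have := z2_modS x s.+1; rewrite -!divn2 => e.
  have : (z2 x s.+2 %/ 2 * 2 = z2 x s.+1 %/ 2 * 2 %[mod 2 ^ s * 2])%N.
    by rewrite !divnK ?dvdn2 ?ev// -expnSr.
  by rewrite -!muln_modl => /eqP; rewrite eqn_pmul2r// => /eqP.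
exists (mkZ2 P); apply: z2_ext => s.
transitivity ((z2 x s.+1) %% 2 ^ s)%N; first by rewrite z2_mod.
rewrite mulr_natl mulr2n z2D /= modnDm addnn.
by rewrite -[in LHS](odd_double_half (z2 x s.+1)) (negbTE (ev _)).
Qed.

(** Bezout inverts each residue modulo [2^s]; the inverses are compatible because an inverse modulo
    [2^s] is unique. *)
Lemma Z2_odd_inv x : ~~ dvd2 1 x -> exists y, y * x = 1.
Proof.
move=> ox.
have cop s : coprime (z2 x s) (2 ^ s).
  case: s => [|s]; first by rewrite coprimen1.
  rewrite coprimeXr// coprimen2; move: ox.
  by rewrite /dvd2 -(@z2_mod x 1 s.+1)// modn2 eqb0 negbK.
have /choice[i iP] : forall s, exists i, (i * z2 x s = 1 %[mod 2 ^ s])%N.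
  move=> s.
  have [x0|x0] := posnP (z2 x s).
    by exists 0%N; have := cop s; rewrite x0 /coprime gcd0n => /eqP ->; rewrite !modn1.
  have [u v e _] := egcdnP (2 ^ s) x0; exists u.
  by rewrite e (eqP (cop s)) -modnDml modnMl add0n.
have P s : (i s.+1 = i s %[mod 2 ^ s])%N.
  apply/eqP.
  have e : (i s.+1 * z2 x s = 1 %[mod 2 ^ s])%N.
    rewrite -modnMmr -(z2_modS x s) modnMmr -[in LHS](@modn_dvdm (2 ^ s.+1)) ?dvdn_exp2l//.
    by rewrite iP modn_dvdm ?dvdn_exp2l.
  have : (i s.+1 * (i s * z2 x s) = i s * (i s.+1 * z2 x s) %[mod 2 ^ s])%N.
    by rewrite mulnCA.
  by rewrite -modnMmr iP modnMmr -[RHS]modnMmr e modnMmr !muln1 => /eqP.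
exists (mkZ2 P); apply: z2_ext => s; rewrite z2M /= modnMml iP.
by [].
Qed.

End Divisibility.

(** * Equivariant towers of clopen partitions *)

Lemma cvg_prod_nat (F : set_system (prod_topology (fun _ : nat => nat)))
    (x : prod_topology (fun _ : nat => nat)) :
  Filter F -> (forall s, F [set y | y s = x s]) -> F --> x.
Proof.
move=> FF Fx; apply/cvg_sup => s U [V] [[W] oW <-] Wx WU.
by apply: (filterS WU); apply: filterS (Fx s) => y /= ->.
Qed.

Lemma nbhs_prod_nat (x : prod_topology (fun _ : nat => nat)) s :
  nbhs x [set y | y s = x s].
Proof. exact: (@proj_continuous nat (fun=> nat) s x _ (discrete_set1 (x s))). Qed.

Section Tower.
(** [D k] is congruence at level [k]. [Tsplit] and [Tpigeon] together make each class of positive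
    level split into exactly two. By [Te] all points return to their class of level [e s] at the
    same times. *)
Variables (T : topologicalType) (f : T -> T) (D : nat -> T -> T -> Prop).
Hypothesis Trefl : forall k x, D k x x.
Hypothesis Tsym : forall k x y, D k x y -> D k y x.
Hypothesis Ttrans : forall k x y z, D k x y -> D k y z -> D k x z.
Hypothesis Tle : forall j k x y, (j <= k)%N -> D k x y -> D j x y.
Hypothesis Tsep : forall x y, (forall k, D k x y) -> x = y.
Hypothesis Tnbhs : forall k x, nbhs x (D k x).
Hypothesis Tcompact : compact [set: T].
Hypothesis Tf : forall k x y, D k (f x) (f y) <-> D k x y.
Hypothesis Tbase : exists r : 'I_3 -> T,
  (forall i j, D 1 (r i) (r j) -> i = j) /\ (forall x, exists i, D 1 (r i) x).
Hypothesis Tsplit : forall k x, (0 < k)%N -> exists y, D k x y /\ ~ D k.+1 x y.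
Hypothesis Tpigeon : forall k x y z, (0 < k)%N -> D k x y -> D k y z ->
  [\/ D k.+1 x y, D k.+1 y z | D k.+1 x z].
Variables (ell : nat) (e : nat -> nat).
Hypothesis ell_gt0 : (0 < ell)%N.
Hypothesis e_gt0 : forall s, (0 < e s)%N.
Hypothesis e_lt : forall s, (e s < e s.+1)%N.
Hypothesis eSS : forall s, e s.+2 = (e s.+1).+1.
Hypothesis Te : forall s x n, D (e s) x (iter n f x) <-> (ell * 2 ^ s %| n)%N.

Let p s := (ell * 2 ^ s)%N.

Let p_gt0 s : (0 < p s)%N. Proof. by rewrite muln_gt0 ell_gt0 expn_gt0. Qed.
Let p_dvd s t : (s <= t)%N -> (p s %| p t)%N.
Proof. by move=> st; rewrite dvdn_pmul2l// dvdn_exp2l. Qed.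

Let e_ge s : (s <= e s)%N.
Proof. by elim: s => // s /leq_ltn_trans; apply. Qed.

Let sep_e x y : (forall s, D (e s) x y) -> x = y.
Proof. by move=> h; apply: Tsep => k; apply: Tle (h k). Qed.

Let iterTf k n x y : D k (iter n f x) (iter n f y) <-> D k x y.
Proof. by elim: n => //= n IH; rewrite Tf. Qed.

Let iterTe s x m n :
  D (e s) (iter m f x) (iter n f x) <-> (m = n %[mod p s])%N.
Proof.
wlog mn : m n / (m <= n)%N => [W|].
  have [/W//|/ltnW /W [h1 h2]] := leqP m n.
  by split=> [/Tsym /h1|/esym /h2 /Tsym].
rewrite -{1}(subnK mn) addnC iterD iterTf Te.
rewrite -/(p s) -eqn_mod_dvd//; split=> [/eqP|->//]; exact: esym.
Qed.

Let cluster_seq (u : nat -> T) : exists y,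
  forall k N, exists2 n, (N <= n)%N & D k y (u n).
Proof.
have [y [_ uy]] := @Tcompact (u @ \oo) _ filterT.
exists y => k N; have [] := uy [set u n | n in [set n | (N <= n)%N]] (D k y).
- by exists N => // n /= Nn; exists n.
- exact: Tnbhs.
- by move=> _ [[n Nn <-] yn]; exists n.
Qed.

(** Otherwise there are [u k] in [D k x] outside [U]. Every cluster point of [u] agrees with [x] at
    all levels, so it is [x], yet [u] avoids the neighbourhood [U] of [x]. *)
Let tower_basis x U : nbhs x U -> exists k, D k x `<=` U.
Proof.
move=> xU; apply: contrapT => /forallNP h.
have /choice[u uP] k : exists y, D k x y /\ ~ U y.
  by have /existsNP[y /not_implyP] := h k; exists y.
have [y yP] := cluster_seq u.
have xy : x = y.
  apply: Tsep => k; have [n kn yn] := yP k k.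
  by apply: Ttrans (Tsym yn); apply: Tle kn (uP n).1.
subst y.
have [z [_ uz]] := @Tcompact (u @ \oo) _ filterT.
have xz : x = z.
  apply: Tsep => k; have [] := uz [set u n | n in [set n | (k <= n)%N]] (D k z).
  - by exists k => // n /= Nn; exists n.
  - exact: Tnbhs.
  - by move=> _ [[n Nn <-] yn]; apply: Ttrans (Tsym yn); apply: Tle Nn (uP n).1.
subst z; have [] := uz (~` U) U _ xU; last by move=> w [].
by exists 0%N => // n _ /=; exact: (uP n).2.
Qed.

(** This clopen set will be the orbit closure. Level [e 1] is the right one, and not [e 0], because
    [e] grows by exactly one only from index 1 on. *)
Definition orbit_hull x : set T := [set y | exists n, D (e 1) (iter n f x) y].

Let orbit_hull_trans x y z : orbit_hull x y -> orbit_hull y z -> orbit_hull x z.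
Proof.
move=> [n xy] [m yz]; exists (m + n)%N; rewrite iterD.
by apply: Ttrans yz; rewrite iterTf.
Qed.

Let orbit_hull_sym x y : orbit_hull x y -> orbit_hull y x.
Proof.
(* The total number of iterations becomes [n * p 1], a return time at level [e 1]. *)
move=> [n xy]; exists (n * (p 1).-1)%N.
apply: (Ttrans (y := iter (n * (p 1).-1) f (iter n f x))).
  by rewrite iterTf; exact: Tsym.
by rewrite -iterD; apply: Tsym; apply/Te; rewrite addnC -mulnS prednK// dvdn_mull.
Qed.

Lemma orbit_hullE x y : orbit_hull x y -> orbit_hull x = orbit_hull y.
Proof.
move=> xy; apply/seteqP; split=> z; apply: orbit_hull_trans => //.
exact: orbit_hull_sym.
Qed.

(* In an e_(s+1)-class both halves are visited: by a point and by its image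
   under the p_(s+1)-st iterate, since the latter is not e_(s+2)-close to it. *)
Let orbit_hull_approx x y s : orbit_hull x y -> exists n, D (e s) (iter n f x) y.
Proof.
case: s => [[n /Tle h]|s xy]; first by exists n; apply/h/ltnW.
elim: s => // s [n xny].
have per : D (e s.+1) (iter (p s.+1) f (iter n f x)) (iter n f x).
  by apply/Tsym/Te.
have [h|h|h] := Tpigeon (e_gt0 _) per xny; rewrite eSS.
- move: h; rewrite -eSS => /Tsym/Te; rewrite -/(p s.+2) -/(p s.+1) => /dvdn_leq.
  by rewrite p_gt0 leq_pmul2l// leq_exp2l// ltnn => /(_ isT).
- by exists n.
- by exists (p s.+1 + n)%N; rewrite iterD.
Qed.

(** Classes are neighbourhoods, which bounds the closure by the hull. Conversely the orbit comes
    [e k]-close to each point of the hull, and [e k] is at least [k]. *)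
Lemma closure_orbit x : closure [set iter n f x | n in [set: nat]] = orbit_hull x.
Proof.
apply/seteqP; split=> [y cy|y xy U /tower_basis[k kU]].
  by have [_ [[n _ <-] yn]] := cy _ (Tnbhs (e 1) y); exists n; exact: Tsym.
have [n nP] := orbit_hull_approx k xy; exists (iter n f x); split; first by exists n.
by apply/kU/Tsym; apply: Tle nP.
Qed.

Lemma orbit_hull_refl x : orbit_hull x x. Proof. by exists 0%N. Qed.

Lemma orbit_hull_minimal x : minimal_subsystem f (orbit_hull x).
Proof.
split; last by move=> y xy; rewrite closure_orbit (orbit_hullE xy).
split; last by move=> _ [y [n ny] <-]; exists n.+1; rewrite iterS Tf.
rewrite -closure_orbit; apply: subclosed_compact Tcompact _ => //.
exact: closed_closure.
Qed.

Lemma minimal_orbit_hull E x : minimal_subsystem f E -> E x -> E = orbit_hull x.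
Proof. by move=> [_ mE] Ex; rewrite -closure_orbit; exact: mE. Qed.

(** Each representative [r i] gets a companion [g i] in its class but not in its half; the
    pigeonhole hypothesis excludes a third half. *)
Lemma tower_representatives k : exists (I : finType) (r : I -> T),
  [/\ #|I| = (3 * 2 ^ k)%N, forall i j, D k.+1 (r i) (r j) -> i = j &
      forall x, exists i, D k.+1 (r i) x].
Proof.
elim: k => [|k [I [r [cI rI rs]]]].
  have [r [rI rs]] := Tbase; exists 'I_3, r; split => //.
  by rewrite card_ord.
have /choice[g gP] i := Tsplit (r i) (ltn0Sn k).
exists (I * bool)%type, (fun ib => if ib.2 then r ib.1 else g ib.1).
have near_r ib : D k.+1 (r ib.1) (if ib.2 then r ib.1 else g ib.1).
  by case: ib => i [] //=; exact: (gP i).1.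
split; first by rewrite card_prod card_bool cI -mulnA -expnSr.
  move=> [i b] [j c] h; have ij : i = j.
    apply: rI; apply: Ttrans (near_r (i, b)) _.
    by apply: Ttrans (Tsym (near_r (j, c))); apply: Tle h.
  subst j; congr pair; case: b c h => [] [] //= h; first by case: (gP i).2.
  by case: (gP i).2; exact: Tsym.
move=> x; have [i ix] := rs x.
have [h|h|h] := Tpigeon (ltn0Sn k) (Tsym (gP i).1) ix.
- by case: (gP i).2; exact: Tsym.
- by exists (i, true).
- by exists (i, false).
Qed.

(** The map permutes the classes of level [e 1] in cycles of common length [p 1], and the union of
    the classes in a cycle is an orbit hull. So [M] is the number of cycles. *)
Lemma tower_decomposition : exists2 M,
  (M * p 1 = 3 * 2 ^ (e 1).-1)%N & decomposed_into_minimal f M.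
Proof.
have [I [r [cI rI rs]]] := tower_representatives (e 1).-1.
rewrite prednK// in rI rs.
(* [g] is the permutation of the class indices induced by [f]. *)
have /choice[g gP] i := rs (f (r i)).
have g_inj : injective g.
  move=> i j ij; apply: rI; apply/Tf; apply: Ttrans (gP j).
  by apply: Tsym; rewrite -ij.
have iter_g n i : D (e 1) (r (iter n g i)) (iter n f (r i)).
  elim: n => //= n IH; apply: Ttrans (gP _) _.
  by rewrite Tf.
have iter_gE n i : (iter n g i == i) = (p 1 %| n)%N.
  apply/eqP/idP => [gi|pn].
    by apply/(Te _ (r i)); have := iter_g n i; rewrite gi.
  apply: rI; apply: Ttrans (iter_g n i) _.
  by apply/Tsym/Te.
have order_g i : order g i = p 1.
  apply/eqP; rewrite eqn_leq; apply/andP; split; last first.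
    by rewrite dvdn_leq ?order_gt0// -(iter_gE _ i) iter_order.
  (* If [p 1] were below the order, the first visit to the [p 1]-st iterate would have index [p 1];
     but that iterate is [i] itself, of index 0. *)
  rewrite leqNgt; apply/negP => /findex_iter.
  have /eqP -> : iter (p 1) g i == i by rewrite iter_gE.
  by rewrite findex0 => p0; have := p_gt0 1; rewrite -p0.
exists (fcard g I).
  rewrite -cI (@fcard_order_set _ g g_inj (p 1) I)//.
  by apply/fintype.subsetP => i _; rewrite inE order_g.
pose E i := orbit_hull (r i).
have EP i j : E i (r j) -> fconnect g i j.
  move=> [n ij]; have -> : j = iter n g i; last exact: fconnect_iter.
  by apply: rI; apply: Ttrans (Tsym ij) _; exact/Tsym/iter_g.
(* The ordinals below [fcard g I] enumerate the cycle roots. *)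
exists (fun k => E (enum_val k)); split.
- by move=> k; exists (r (enum_val k)); exact: orbit_hull_refl.
- by move=> k; exact: orbit_hull_minimal.
- apply/trivIsetP => /= k l _ _; apply: contra_neqP => /eqP/set0P[y [ky ly]].
  apply: enum_val_inj.
  have /andP[/eqP rk _] := enum_valP k; have /andP[/eqP rl _] := enum_valP l.
  rewrite -rk -rl; apply/(fingraph.rootP (fconnect_sym g_inj))/EP.
  by rewrite /E (orbit_hullE ky) -(orbit_hullE ly); exact: orbit_hull_refl.
- apply/seteqP; split=> // y _; have [i iy] := rs y.
  have jr : froot g i \in [predI froots g & I].
    by apply/andP; split=> //; exact: (roots_root (fconnect_sym g_inj)).
  exists (enum_rank_in jr (froot g i)) => //=; rewrite enum_rankK_in//.
  have : fconnect g (froot g i) i by rewrite fconnect_sym// connect_root.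
  move=> /iter_findex gi; exists (findex g (froot g i) i).
  by apply: Ttrans iy; rewrite -[in X in D _ _ (r X)]gi; exact/Tsym/iter_g.
Qed.

(** The visiting time of the class of [y] at level [e s], modulo the period [p s]. The default 0 is
    never taken on the hull of [x]. *)
Definition orbit_address x : T -> prod_topology (fun _ : nat => nat) :=
  fun y s => xget 0%N [set n | (n < p s)%N /\ D (e s) (iter n f x) y].

(** Inverse of the address; the default [x] does not occur on the odometer, where compactness
    supplies a point. *)
Definition orbit_point x (a : prod_topology (fun _ : nat => nat)) : T :=
  xget x [set y | forall s, D (e s) (iter (a s) f x) y].

Lemma orbit_addressP x y s : orbit_hull x y ->
  (orbit_address x y s < p s)%N /\ D (e s) (iter (orbit_address x y s) f x) y.
Proof.
move=> xy; rewrite /orbit_address; case: xgetP => [n _ //|h].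
have [n ny] := orbit_hull_approx s xy; case: (h (n %% p s)%N); split.
  by rewrite ltn_mod.
by apply: Ttrans ny; apply/iterTe; rewrite modn_mod.
Qed.

Lemma orbit_address_unique x y s n : orbit_hull x y -> (n < p s)%N ->
  D (e s) (iter n f x) y -> orbit_address x y s = n.
Proof.
move=> xy np ny; have [ap ay] := orbit_addressP s xy.
by have /iterTe := Ttrans ay (Tsym ny); rewrite !modn_small.
Qed.

Lemma orbit_address_odometer x y : orbit_hull x y -> odometer p (orbit_address x y).
Proof.
move=> xy s; have [ap ay] := orbit_addressP s xy; split=> //.
have [bp byy] := orbit_addressP s.+1 xy; apply/esym.
apply: orbit_address_unique; rewrite ?ltn_mod//.
apply: Ttrans (Tle (ltnW (e_lt s)) byy).
by apply/iterTe; rewrite modn_mod.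
Qed.

Lemma odometer_mod a s t : odometer p a -> (s <= t)%N -> (a t %% p s)%N = a s.
Proof.
move=> oa /subnK <-; elim: (t - s)%N => [|k IH].
  by rewrite modn_small// (oa s).1.
rewrite -IH addSn -[X in (_ = X %% _)%N](oa _).2 modn_dvdm// p_dvd//.
by rewrite leq_addl.
Qed.

Lemma orbit_pointP x a s : odometer p a -> D (e s) (iter (a s) f x) (orbit_point x a).
Proof.
move=> oa; rewrite /orbit_point; case: xgetP => [y _ //|].
(* By compatibility of the residues, the iterates of order [a t] with [s <= t] share one class of
   level [e s], so a cluster point lies in all these classes. *)
have [y yP] := cluster_seq (fun s => iter (a s) f x).
case/(_ y) => {}s; have [t st yt] := yP (e s) s.
by apply: Ttrans (Tsym yt); apply/iterTe; rewrite -(odometer_mod oa st) modn_mod.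
Qed.

Lemma orbit_hull_odometer x :
  topologically_conjugate f (orbit_hull x) (adding_machine p) (odometer p).
Proof.
have point_hull a : odometer p a -> orbit_hull x (orbit_point x a).
  by move=> oa; exists (a 1); exact: orbit_pointP.
exists (orbit_address x), (orbit_point x); split.
- split; apply/subspace_continuousP.
    move=> y xy; apply: cvg_prod_nat => s.
    apply: (filterS _ (Tnbhs (e s) y)) => z yz xz /=.
    have [ap ay] := orbit_addressP s xy; apply: orbit_address_unique => //.
    exact: Ttrans ay yz.
  move=> a oa U /tower_basis[k kU].
  apply: (filterS _ (nbhs_prod_nat a k)) => b /= ab ob.
  apply/kU/(Tle (e_ge k)); apply: Ttrans (Tsym (orbit_pointP x k oa)) _.
  by rewrite -ab; exact: orbit_pointP.
- by move=> _ [y xy <-]; exact: orbit_address_odometer.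
- by move=> _ [a oa <-]; exact: point_hull.
- split=> [y xy|a oa].
    apply: sep_e => s.
    apply: Ttrans (Tsym (orbit_pointP x s (orbit_address_odometer xy))) _.
    exact: (orbit_addressP s xy).2.
  apply/funext => s; apply: orbit_address_unique; first exact: point_hull.
    exact: (oa s).1.
  exact: orbit_pointP.
- move=> y xy; apply/funext => s.
  have [ap ay] := orbit_addressP s xy; apply: orbit_address_unique.
  + by case: xy => n ny; exists n.+1; rewrite iterS Tf.
  + by rewrite ltn_mod.
  + apply: (Ttrans (y := iter (orbit_address x y s).+1 f x)).
      by apply/iterTe; rewrite modn_mod.
    by rewrite iterS Tf.
Qed.

Lemma minimal_odometer E : E !=set0 -> minimal_subsystem f E ->
  topologically_conjugate f E (adding_machine p) (odometer p).
Proof.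
by move=> [x Ex] mE; rewrite (minimal_orbit_hull mE Ex); exact: orbit_hull_odometer.
Qed.

End Tower.

(** * The projective line over Q_2 and its residue classes *)

(** Its divisibility by [2^k] expresses that two primitive pairs are proportional modulo [2^k]. *)
Definition cross (p q : Z2 * Z2) : Z2 := p.1 * q.2 - p.2 * q.1.

Definition primitive (p : Z2 * Z2) : bool := ~~ (dvd2 1 p.1 && dvd2 1 p.2).

Section PrimitivePairs.
Implicit Types p q r : Z2 * Z2.

Lemma crossNC p q : cross p q = - cross q p.
Proof. by rewrite /cross; ring. Qed.

Lemma dvd2_crossC k p q : dvd2 k (cross p q) = dvd2 k (cross q p).
Proof. by rewrite crossNC dvd2N. Qed.

(** A Pluecker relation: one of the coordinates of a primitive [q] is odd and can be cancelled, so
    [cross p r] is controlled by the other two cross products. *)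
Lemma cross_pluecker1 p q r :
  q.1 * cross p r = p.1 * cross q r + r.1 * cross p q.
Proof. by rewrite /cross; ring. Qed.

Lemma cross_pluecker2 p q r :
  q.2 * cross p r = p.2 * cross q r + r.2 * cross p q.
Proof. by rewrite /cross; ring. Qed.

Lemma primitive_odd p : primitive p -> {~~ dvd2 1 p.1} + {~~ dvd2 1 p.2}.
Proof. by rewrite /primitive negb_and; case: (dvd2 1 p.1) => /=; [right|left]. Qed.

(** Nonzero vectors over the field with two elements are proportional only if they are equal. *)
Lemma cross_parity p q : primitive p -> primitive q ->
  dvd2 1 (cross p q) =
  (dvd2 1 p.1 == dvd2 1 q.1) && (dvd2 1 p.2 == dvd2 1 q.2).
Proof.
rewrite /primitive /cross dvd2_1D dvd2N !dvd2_1M.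
by case: (dvd2 1 p.1); case: (dvd2 1 p.2); case: (dvd2 1 q.1); case: (dvd2 1 q.2).
Qed.

Lemma dvd2_cross_trans k p q r : primitive q ->
  dvd2 k (cross p q) -> dvd2 k (cross q r) -> dvd2 k (cross p r).
Proof.
move=> qprim pq qr; case: (primitive_odd qprim) => /dvd2_oddMl <-.
  by rewrite cross_pluecker1 dvd2D// dvd2Mr.
by rewrite cross_pluecker2 dvd2D// dvd2Mr.
Qed.

Lemma dvd2_cross_pigeon k p q r : (0 < k)%N ->
  primitive p -> primitive q -> primitive r ->
  dvd2 k (cross p q) -> dvd2 k (cross q r) ->
  [|| dvd2 k.+1 (cross p q), dvd2 k.+1 (cross q r) | dvd2 k.+1 (cross p r)].
Proof.
move=> k0 pp qp rp pq qr; have [pq1 qr1] := (dvd2_le k0 pq, dvd2_le k0 qr).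
rewrite (cross_parity pp qp) in pq1; rewrite (cross_parity qp rp) in qr1.
case/andP: pq1 => /eqP p1 /eqP p2; case/andP: qr1 => /eqP q1 /eqP q2.
(* The three pairs have the same parities, so all coefficients of the Pluecker relation at the odd
   coordinate are odd, and [dvd2DSE] decides the sum. *)
have -> : dvd2 k.+1 (cross p r) = (dvd2 k.+1 (cross q r) == dvd2 k.+1 (cross p q)).
  case: (primitive_odd qp) => qo.
    rewrite -(dvd2_oddMl _ _ qo) cross_pluecker1.
    by rewrite (dvd2DSE (dvd2Mr _ qr) (dvd2Mr _ pq)) !dvd2_oddMl -?q1 ?p1.
  rewrite -(dvd2_oddMl _ _ qo) cross_pluecker2.
  by rewrite (dvd2DSE (dvd2Mr _ qr) (dvd2Mr _ pq)) !dvd2_oddMl -?q2 ?p2.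
by case: (dvd2 k.+1 (cross p q)); case: (dvd2 k.+1 (cross q r)).
Qed.

End PrimitivePairs.

(** * Fractions of 2-adic integers, absolute values and compactness in Q_2 *)

Lemma Z2_inv_exp2 k (d : Z2) : ~~ dvd2 k d -> exists y, y * d = 2 ^+ k.
Proof.
elim: k d => [|k IH] d; first by rewrite dvd2_0l.
have [/Z2_half[d' ->]|/Z2_odd_inv[y yd] _] := boolP (dvd2 1 d).
  by rewrite dvd2_2M => /IH[y yd]; exists y; rewrite mulrCA yd exprS.
by exists (y * 2 ^+ k.+1); rewrite mulrAC yd mul1r.
Qed.

(* Locked, so that no conversion problem unfolds fractions. *)
Definition q2 : Z2 -> Q2 := locked (@tofrac Z2).

Lemma q2D x y : q2 (x + y) = q2 x + q2 y. Proof. rewrite /q2 -lock; exact: rmorphD. Qed.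
Lemma q2B x y : q2 (x - y) = q2 x - q2 y. Proof. rewrite /q2 -lock; exact: rmorphB. Qed.
Lemma q2M x y : q2 (x * y) = q2 x * q2 y. Proof. rewrite /q2 -lock; exact: rmorphM. Qed.
Lemma q2_0 : q2 0 = 0. Proof. rewrite /q2 -lock; exact: rmorph0. Qed.
Lemma q2_1 : q2 1 = 1. Proof. rewrite /q2 -lock; exact: rmorph1. Qed.
Lemma q2_nat n : q2 n%:R = n%:R. Proof. rewrite /q2 -lock; exact: rmorph_nat. Qed.
Lemma q2_eq0 x : (q2 x == 0) = (x == 0). Proof. rewrite /q2 -lock; exact: tofrac_eq0. Qed.
Lemma q2_inj : injective q2.
Proof. by move=> x y; rewrite /q2 -lock => /eqP; rewrite tofrac_eq => /eqP. Qed.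

Lemma Q2_2_neq0 : 2 != 0 :> Q2.
Proof. by rewrite -(q2_nat 2) q2_eq0 Z2_2_neq0. Qed.

(** Common factors 2 are removed by induction on the order of the denominator. *)
Lemma Q2_primitive (z : Q2) : exists p : Z2 * Z2,
  [/\ primitive p, p.2 != 0 & q2 p.1 = z * q2 p.2].
Proof.
have [n [d [d0 /esym e _]]] := Q2_numdenE rat z.
have {}e : q2 n = z * q2 d by rewrite /q2 -lock.
have [m] := ubnP (ord2 d); elim: m => // m IH in n d d0 e *; rewrite ltnS => dm.
have [/andP[/= n2 d2]|pr] := boolP (dvd2 1 n && dvd2 1 d); last by exists (n, d).
have [n' n'E] := Z2_half n2; have [d' d'E] := Z2_half d2; subst n d.
have d'0 : d' != 0 by apply: contraNneq d0 => ->; rewrite mulr0.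
apply: (IH n' d') => //.
  move: e; rewrite !q2M mulrCA => /mulfI; apply.
  by rewrite q2_eq0 Z2_2_neq0.
by rewrite ord2M ?Z2_2_neq0// ord2_2 in dm.
Qed.

Lemma absZ2_odd (R : realFieldType) d : ~~ dvd2 1 d -> absZ2 R d = 1.
Proof.
move=> d1; have d0 : d != 0 by apply: contraNneq d1 => ->; exact: dvd2_0r.
rewrite /absZ2 (negbTE d0); move: d1; rewrite dvd2_ord//.
by case: (ord2 d) => //; rewrite expr0 invr1.
Qed.

Lemma absZ2_le_exp (R : realFieldType) k n : (absZ2 R n <= 2 ^- k) = dvd2 k n.
Proof.
rewrite /absZ2; have [->|n0] := eqVneq n 0.
  by rewrite dvd2_0r invr_ge0 exprn_ge0.
by rewrite dvd2_ord// lef_pV2 ?posrE ?exprn_gt0// ler_eXn2l// ltr1n.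
Qed.

Lemma absZ2_lt1 (R : realFieldType) n : (absZ2 R n < 1) = dvd2 1 n.
Proof.
rewrite /absZ2; have [->|n0] := eqVneq n 0; first by rewrite dvd2_0r ltr01.
rewrite dvd2_ord//; case: (ord2 n) => [|k]; first by rewrite expr0 invr1 ltxx.
by rewrite invf_lt1 ?exprn_gt0// exprn_egt1// ltr1n.
Qed.

Lemma absval_gt0 (R : realFieldType) (F : fieldType) (v : absolute_value R F) x :
  (0 < v x) = (x != 0).
Proof. by rewrite lt_def absval_eq0 absval_ge0 andbT. Qed.

Lemma abs2_q2 (R : realFieldType) n : abs2 R (q2 n) = absZ2 R n.
Proof.
rewrite /q2 -lock.
rewrite /abs2 /absval (@abs2_frac R _ n 1) ?oner_neq0//.
  by rewrite (@absZ2_odd R 1)// invr1 mulr1.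
by rewrite rmorph1 mulr1.
Qed.

Lemma abs2_le_exp k (z : Q2) : abs2 rat z <= 2 ^- k ->
  exists2 t, z = q2 t & dvd2 k t.
Proof.
have [[n d] [/= pr d0 e]] := Q2_primitive z.
have ed : abs2 rat z = absZ2 rat n / absZ2 rat d.
  by rewrite -!abs2_q2 e absvalM mulfK// absval_eq0 q2_eq0.
rewrite ed ler_pdivrMr ?lt_def ?absZ2_eq0 ?d0 ?absZ2_ge0// => le.
have k1 : 2 ^- k <= 1 :> rat by rewrite invf_le1 ?exprn_gt0// exprn_ege1// ler1n.
(* An even [d] would force [|n| <= |d| < 1], so [n] would be even too, against primitivity. *)
have d1 : ~~ dvd2 1 d.
  apply/negP => d1; move/negP: pr; apply; rewrite /= d1 andbT -(absZ2_lt1 rat).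
  apply: le_lt_trans le _; apply: (@le_lt_trans _ _ (absZ2 rat d)).
    by rewrite ler_piMl ?absZ2_ge0.
  by rewrite absZ2_lt1.
have [y yd] := Z2_odd_inv d1; exists (n * y).
  by rewrite q2M e mulrAC -mulrA -q2M mulrC yd q2_1 mul1r.
by apply: dvd2Ml; rewrite -(absZ2_le_exp rat); rewrite (absZ2_odd rat d1) mulr1 in le.
Qed.

Lemma exp2V_small (C eps : rat) : 0 < eps -> exists s : nat, 2 ^- s * C < eps.
Proof.
move=> eps0; exists (Num.bound (C / eps)); rewrite mulrC ltr_pdivrMr ?exprn_gt0//.
by rewrite mulrC -ltr_pdivrMr//; exact: upper_nthrootP.
Qed.

Lemma nbhs_Q2P (x : Q2) (U : set Q2) :
  nbhs x U <-> exists2 eps : rat, 0 < eps & Q2_ball x eps `<=` U.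
Proof. exact: (@nbhs_ballP rat Q2). Qed.

(* An ultrafilter on the affine image of Z_2 selects a residue modulo every
   power of 2; the selected residues form the limit. *)
Lemma compact_Z2_affine (c b : Q2) : c != 0 ->
  compact (range (fun t : Z2 => q2 t * c + b) : set Q2).
Proof.
move=> c0; set g : Z2 -> Q2 := fun t => q2 t * c + b.
have g_inj : injective g.
  by move=> t t' /addIr /(mulIf c0) /q2_inj.
rewrite compact_ultra => F FU Fg.
pose S s r := g @` [set t | z2 t s = r].
have /choice[r rP] s : exists r, F (S s r).
  have : F (g @` [set t | (z2 t s < 2 ^ s)%N]).
    by apply: filterS Fg => _ [t _ <-]; exists t => //=; exact: z2_lt.
  elim: (2 ^ s)%N => [|m IH].
    by move=> /filter_ex[x [t]].
  case: (in_ultra_setVsetC (S s m) FU); first by exists m.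
  move=> Fm FmS; apply: IH; apply: filterS2 Fm FmS => x + [t /= tm tx].
  rewrite -{}tx => nx; exists t => //=; move: tm; rewrite ltnS leq_eqVlt => /orP[/eqP tm|//].
  by case: nx; exists t.
have P s : (r s.+1 = r s %[mod 2 ^ s])%N.
  have [_ [[t ts <-] [t' ts' /g_inj e]]] := filter_ex (filterI (rP s.+1) (rP s)).
  by subst t'; rewrite -ts -ts' z2_modS.
have r_lt s : (r s < 2 ^ s)%N.
  by have [_ [t <- _]] := filter_ex (rP s); exact: z2_lt.
exists (g (mkZ2 P)); split; first by exists (mkZ2 P).
move=> U /nbhs_Q2P[eps eps0 epsU].
have [s sP] := exp2V_small (abs2 rat c) eps0.
apply: filterS (rP s) => _ [t ts <-]; apply: epsU; rewrite /Q2_ball /=.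
apply: le_lt_trans sP; rewrite /g opprD addrACA subrr addr0 -mulrBl -q2B.
rewrite absvalM ler_wpM2r ?absval_ge0// abs2_q2 absZ2_le_exp.
by apply: dvd2_sub; rewrite ts /= modn_small.
Qed.

Lemma cross_affine (F : fieldType) (A B u v d d' : F) :
  d * (A * u + B) * d' - d * (d' * (A * v + B)) = d * d' * (A * (u - v)).
Proof. by ring. Qed.

Lemma affine_section (F : fieldType) (A B n d : F) : A != 0 -> d != 0 ->
  n = d * (A * ((n / d - B) / A) + B).
Proof. by move=> A0 d0; field; apply/andP. Qed.

Lemma affine_cancel (F : fieldType) (A B k t : F) : A != 0 -> k != 0 ->
  t = k * (A * (t * (k * A)^-1 + - B / A) + B).
Proof. by move=> A0 k0; field; apply/andP. Qed.

Lemma affine_cancelV (F : fieldType) (A B k u : F) : A != 0 -> k != 0 ->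
  k * (A * u + B) * (k * A)^-1 + - B / A = u.
Proof. by move=> A0 k0; field; apply/andP. Qed.

Lemma affine_shift (F : fieldType) (A B k u v : F) :
  k * A * (u - v) + k * (A * v + B) = k * (A * u + B).
Proof. by ring. Qed.

(** * Residue classes of the projective line *)

Section Classes.
Variables (A B : Q2).
Hypothesis A_neq0 : A != 0.

Definition homog (x : P1Q2) : Q2 * Q2 := if x is Some u then (A * u + B, 1) else (1, 0).

Definition represents (p : Z2 * Z2) (x : P1Q2) : Prop :=
  q2 p.1 * (homog x).2 = q2 p.2 * (homog x).1.

Lemma represents_ex x : exists p, primitive p /\ represents p x.
Proof.
case: x => [u|]; last by exists (1, 0); rewrite /represents /= q2_0 mulr0 mul0r.
have [p [pp p2 pE]] := Q2_primitive (A * u + B); exists p; split=> //.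
by rewrite /represents /= mulr1 pE mulrC.
Qed.

(** A chosen primitive representative; [classP] shows that the classes do not depend on the
    choice. *)
Definition coord x : Z2 * Z2 := sval (cid (represents_ex x)).

Lemma primitive_coord x : primitive (coord x).
Proof. by rewrite /coord; case: cid => p []. Qed.

Lemma represents_coord x : represents (coord x) x.
Proof. by rewrite /coord; case: cid => p []. Qed.

Hint Resolve primitive_coord represents_coord : core.

Lemma represents_surj p : primitive p -> exists x, represents p x.
Proof.
move=> pp; have [p2|p2] := eqVneq p.2 0.
  by exists None; rewrite /represents /= p2 q2_0 mulr0 mul0r.
exists (Some ((q2 p.1 / q2 p.2 - B) / A)); rewrite /represents /= mulr1.
by rewrite -q2_eq0 in p2; exact: (affine_section B (q2 p.1) A_neq0 p2).
Qed.

Lemma represents_cross p q x : represents p x -> represents q x -> cross p q = 0.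
Proof.
rewrite /represents => px qx; apply/eqP; rewrite -q2_eq0 /cross q2B !q2M.
case: x px qx => [u|] /=; rewrite ?mulr1 ?mulr0.
  by move=> -> ->; apply/eqP; ring.
by move=> <- <-; rewrite mulr0 mul0r subrr.
Qed.

Lemma cross0_eq p q x y : primitive p -> primitive q ->
  represents p x -> represents q y -> cross p q = 0 -> x = y.
Proof.
have nz r : primitive r -> (r.1 == 0) && (r.2 == 0) = false.
  move=> /negP rp; apply/negP => /andP[/eqP r1 /eqP r2]; apply: rp.
  by rewrite r1 r2 !dvd2_0r.
move=> /nz p0 /nz q0; rewrite /represents => px qy /(congr1 q2).
rewrite /cross q2B !q2M q2_0; move: p0 q0 px qy.
rewrite -!(q2_eq0 (_ : Z2)).
move: (q2 p.1) (q2 p.2) (q2 q.1) (q2 q.2) => n d n' d' nd nd'.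
case: x y => [u|] [v|] //=; rewrite ?mulr1 ?mulr0.
- move=> nE nE'; have d0 : d != 0.
    by apply: contraFneq nd => d0; rewrite nE d0 mul0r eqxx.
  have d0' : d' != 0.
    by apply: contraFneq nd' => d0'; rewrite nE' d0' mul0r eqxx.
  move=> /eqP; rewrite nE nE' cross_affine !mulf_eq0 (negbTE d0) (negbTE d0').
  by rewrite (negbTE A_neq0) subr_eq0 => /= /eqP ->.
- move=> nE dE' /eqP; rewrite nE -dE' mulr0 sub0r oppr_eq0 mulf_eq0.
  move=> /orP[/eqP d0|/eqP n0']; first by rewrite nE d0 mul0r eqxx in nd.
  by rewrite n0' -dE' eqxx in nd'.
- move=> dE nE' /eqP; rewrite nE' -dE mul0r subr0 mulf_eq0.
  move=> /orP[/eqP n0|/eqP d0']; first by rewrite n0 -dE eqxx in nd.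
  by rewrite nE' d0' mul0r eqxx in nd'.
Qed.

Definition class k (x y : P1Q2) : Prop := dvd2 k (cross (coord x) (coord y)).

Lemma classP k p q x y : primitive p -> primitive q ->
  represents p x -> represents q y -> class k x y <-> dvd2 k (cross p q).
Proof.
move=> pp qq px qy; rewrite /class.
have cp : dvd2 k (cross (coord x) p) by rewrite (represents_cross _ px) ?dvd2_0r.
have cq : dvd2 k (cross (coord y) q) by rewrite (represents_cross _ qy) ?dvd2_0r.
split=> h.
  apply: dvd2_cross_trans (primitive_coord y) _ cq.
  by apply: dvd2_cross_trans (primitive_coord x) _ h; rewrite dvd2_crossC.
rewrite dvd2_crossC in cq.
by apply: dvd2_cross_trans qq _ cq; apply: dvd2_cross_trans pp cp h.
Qed.

Lemma class_refl k x : class k x x.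
Proof. by rewrite /class /cross mulrC subrr dvd2_0r. Qed.

Lemma class_sym k x y : class k x y -> class k y x.
Proof. by rewrite /class dvd2_crossC. Qed.

Lemma class_trans k x y z : class k x y -> class k y z -> class k x z.
Proof. exact: dvd2_cross_trans. Qed.

Lemma class_le j k x y : (j <= k)%N -> class k x y -> class j x y.
Proof. exact: dvd2_le. Qed.

Lemma class_sep x y : (forall k, class k x y) -> x = y.
Proof.
move=> h; apply: (@cross0_eq (coord x) (coord y)) => //.
by apply: z2_ext => s; rewrite z2_0; exact/eqP/(h s).
Qed.

Lemma class_pigeon k x y z : (0 < k)%N -> class k x y -> class k y z ->
  [\/ class k.+1 x y, class k.+1 y z | class k.+1 x z].
Proof. by move=> k0 xy yz; apply/or3P; apply: dvd2_cross_pigeon. Qed.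

Lemma class_split k x : (0 < k)%N -> exists y, class k x y /\ ~ class k.+1 x y.
Proof.
move=> k0; have pp := primitive_coord x; set p := coord x in pp.
have /andP[k2 /negP k2'] := dvd2_exp k.
have k21 := dvd2_le k0 k2.
suff [q qp [qk qk']] : exists2 q, primitive q &
    dvd2 k (cross p q) /\ ~ dvd2 k.+1 (cross p q).
  have [y yq] := represents_surj qp; exists y.
  have e j := classP j pp qp (represents_coord x) yq.
  by split; [exact/e | move/e].
(* Adding [2^k] to the coordinate other than the odd one changes the cross product from 0 to an odd
   multiple of [2^k]. *)
case: (primitive_odd pp) => po.
  exists (p.1, p.2 + 2 ^+ k); first by rewrite /primitive /= negb_and po.
  have -> : cross p (p.1, p.2 + 2 ^+ k) = p.1 * 2 ^+ k by rewrite /cross /=; ring.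
  by rewrite !dvd2_oddMl.
exists (p.1 + 2 ^+ k, p.2); first by rewrite /primitive /= negb_and po orbT.
have -> : cross p (p.1 + 2 ^+ k, p.2) = p.2 * - 2 ^+ k by rewrite /cross /=; ring.
by rewrite !dvd2_oddMl// !dvd2N.
Qed.

Lemma class_base : exists r : 'I_3 -> P1Q2,
  (forall i j, class 1 (r i) (r j) -> i = j) /\ (forall x, exists i, class 1 (r i) x).
Proof.
pose q (i : 'I_3) : Z2 * Z2 := tnth [tuple (1, 0); (0, 1); (1, 1)] i.
have qp i : primitive (q i) by case: i => -[|[|[|]]].
have /choice[r rP] i := represents_surj (qp i).
exists r; split=> [i j /(classP _ (qp i) (qp j) (rP i) (rP j))|x].
  rewrite cross_parity// => /andP[/eqP h1 /eqP h2]; apply/val_inj; move: h1 h2.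
  by case: i => -[|[|[|]]]//= ?; case: j => -[|[|[|]]].
have [i iP] : exists i, (dvd2 1 (q i).1 == dvd2 1 (coord x).1) &&
                      (dvd2 1 (q i).2 == dvd2 1 (coord x).2).
  have := primitive_coord x; rewrite /primitive.
  case: (dvd2 1 (coord x).1); case: (dvd2 1 (coord x).2) => // _.
  - by exists (@Ordinal 3 1 isT).
  - by exists (@Ordinal 3 0 isT).
  - by exists (@Ordinal 3 2 isT).
exists i; apply/(classP _ (qp i) (primitive_coord x) (rP i) (represents_coord x)).
by rewrite cross_parity.
Qed.

Lemma class_nbhs k x : nbhs x (class k x).
Proof.
case: x => [u|].
  have pu := represents_coord (Some u); have pp := primitive_coord (Some u).
  move: (coord _) pu pp => p; rewrite /represents /= mulr1 => pu pp.
  have p20 : p.2 != 0.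
    apply: contraTneq pp => p2; move/eqP: pu; rewrite p2 q2_0 mul0r q2_eq0.
    by move=> /eqP p1; rewrite /primitive p1 p2 !dvd2_0r.
  rewrite -q2_eq0 in p20; have p2A0 : 0 < abs2 rat (q2 p.2 * A).
    by rewrite absval_gt0; exact: (mulf_neq0 p20 A_neq0).
  (* With this radius the numerator moves by some [t] divisible by [2^(k+1)]. The extra factor 2
     keeps the pair primitive even for [k = 0]. *)
  apply/nbhs_Q2P; exists (2 ^- k.+1 / abs2 rat (q2 p.2 * A)).
    by rewrite divr_gt0// invr_gt0 exprn_gt0.
  move=> v; rewrite /Q2_ball /= -absvalN opprB ltr_pdivlMr// mulrC -absvalM => /ltW.
  move=> /abs2_le_exp[t tE tk].
  have t1 := dvd2_le (ltn0Sn k) tk.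
  apply/(@classP k p (p.1 + t, p.2)) => //.
  - by rewrite /primitive /= dvd2_1D t1 eqb_id.
  - by rewrite /represents /= mulr1.
  - by rewrite /represents /= mulr1 q2D -tE pu; ring.
  - have -> : cross p (p.1 + t, p.2) = - (p.2 * t) by rewrite /cross /=; ring.
    by rewrite dvd2N dvd2Mr// (dvd2_le (leqnSn k)).
have k0 : q2 (2 ^+ k) != 0 by rewrite q2_eq0 expf_neq0 ?Z2_2_neq0.
have kA0 := mulf_neq0 k0 A_neq0.
(* [U] consists of the [u] with [2^k (A u + B)] in Z_2. It is compact and closed, and outside it
   points are congruent to infinity. *)
pose U : set Q2 := range (fun t : Z2 => q2 t * (q2 (2 ^+ k) * A)^-1 + - B / A).
have UE u : U u <-> exists t, q2 t = q2 (2 ^+ k) * (A * u + B).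
  split=> -[t]; first by move=> _ <-; exists t;
    exact: (affine_cancel B _ A_neq0 k0).
  move=> te; exists t; first exact: I.
  by rewrite te; exact: (affine_cancelV B _ A_neq0 k0).
exists U.
  split; first by apply: compact_Z2_affine; exact: (invr_neq0 kA0).
  rewrite -openC openE => u nUu; rewrite /interior nbhs_Q2P.
  have kA_gt0 : 0 < abs2 rat (q2 (2 ^+ k) * A) by rewrite absval_gt0.
  exists (abs2 rat (q2 (2 ^+ k) * A))^-1; first by rewrite /= invr_gt0.
  move=> v + /UE[t te]; rewrite /Q2_ball /= -[X in _ < X]mul1r ltr_pdivlMr//.
  rewrite mulrC -absvalM => /ltW kuv.
  have [t' te' _] : exists2 t', q2 (2 ^+ k) * A * (u - v) = q2 t' & dvd2 0 t'.
    by apply: abs2_le_exp; rewrite expr0 invr1.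
  apply: nUu; apply/UE; exists (t' + t).
  by rewrite q2D -te' te; exact: (affine_shift A B).
move=> [u|]; last by move=> _; exact: class_refl.
move=> [[v nUu [vu]]|//]; subst v.
have pu := represents_coord (Some u); have pp := primitive_coord (Some u).
apply/(@classP k (1, 0) (coord (Some u))) => //.
  by rewrite /represents /= q2_0 mulr0 mul0r.
rewrite /cross /= mul1r mul0r subr0.
(* If [2^k] does not divide the denominator, the denominator divides [2^k], which puts [u] in
   [U]. *)
apply: contraT => /Z2_inv_exp2[y yd]; case: nUu; apply/UE.
exists (y * (coord (Some u)).1); move: pu; rewrite /represents /= mulr1 q2M => ->.
by rewrite mulrA -q2M yd.
Qed.

End Classes.

(** * Eisenstein integers over Z_2 *)

(* The pair p stands for p.1 + p.2 w, where w^2 + w + 1 = 0. *)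
Definition eisM (p q : Z2 * Z2) : Z2 * Z2 :=
  (p.1 * q.1 - p.2 * q.2, p.1 * q.2 + p.2 * q.1 - p.2 * q.2).

Definition eis_norm (p : Z2 * Z2) : Z2 := p.1 ^+ 2 - p.1 * p.2 + p.2 ^+ 2.

Definition eisX (p : Z2 * Z2) n : Z2 * Z2 := iter n (eisM p) (1, 0).

Section Eisenstein.
Implicit Types p q m : Z2 * Z2.

Lemma eisMA p q m : eisM p (eisM q m) = eisM (eisM p q) m.
Proof. by rewrite /eisM /=; congr pair; ring. Qed.

Lemma eis_normM p q : eis_norm (eisM p q) = eis_norm p * eis_norm q.
Proof. by rewrite /eisM /eis_norm /=; ring. Qed.

(** The norm form has no nontrivial zero modulo 2, so primitive pairs are exactly the units. *)
Lemma eis_norm_odd p : ~~ dvd2 1 (eis_norm p) = primitive p.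
Proof.
rewrite /eis_norm /primitive !dvd2_1D dvd2N !dvd2_1M.
by case: (dvd2 1 p.1); case: (dvd2 1 p.2).
Qed.

Lemma primitive_eisM p q : primitive p -> primitive q -> primitive (eisM p q).
Proof. by rewrite -!eis_norm_odd eis_normM => po qo; rewrite dvd2_oddMl. Qed.

Lemma cross_eisM m p q : cross (eisM m p) (eisM m q) = eis_norm m * cross p q.
Proof. by rewrite /cross /eisM /eis_norm /=; ring. Qed.

(** The displacement of a primitive [p] depends on [m] only, up to a unit: this makes return times
    the same for all points. *)
Lemma cross_eisMr m p : cross p (eisM m p) = eis_norm p * m.2.
Proof. by rewrite /cross /eisM /eis_norm /=; ring. Qed.

Lemma eisM1 p : eisM (1, 0) p = p.
Proof. by case: p => x y; rewrite /eisM /=; congr pair; ring. Qed.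

Lemma iter_eisM m p n : iter n (eisM m) p = eisM (eisX m n) p.
Proof. by elim: n => [|n IH]; rewrite /eisX ?eisM1//= IH eisMA. Qed.

Lemma eisXD m j n : eisX m (j + n) = eisM (eisX m j) (eisX m n).
Proof. by rewrite {1}/eisX iterD iter_eisM. Qed.

Lemma primitive_eisX m n : primitive m -> primitive (eisX m n).
Proof. by move=> mp; elim: n => // n IH; exact: primitive_eisM. Qed.

End Eisenstein.

Section EisensteinOrder.
Variables (m : Z2 * Z2) (ell : nat).
Hypothesis m_primitive : primitive m.
Hypothesis m_aperiodic : forall n, (0 < n)%N -> (eisX m n).2 != 0.
Hypothesis ell_gt0 : (0 < ell)%N.
Hypothesis ellP : forall n, dvd2 1 (eisX m n).2 = (ell %| n)%N.

Let u n := (eisX m n).1.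
Let v n := (eisX m n).2.

Let vD j n : v (j + n) = u j * v n + v j * (u n - v n).
Proof. by rewrite /v eisXD /= -/(u _) -/(u _) -/(v _) -/(v _); ring. Qed.

Let v2n n : v (n * 2) = v n * (2 * u n - v n).
Proof. by rewrite muln2 -addnn vD; ring. Qed.

Let u_odd n : dvd2 1 (v n) -> ~~ dvd2 1 (u n).
Proof.
by have := primitive_eisX n m_primitive; rewrite /primitive -/(u n) -/(v n) => /nandP[|/negP].
Qed.

(** The level up to which the iterate of order [ell * 2^s] is the identity. *)
Definition eis_depth s := ord2 (v (ell * 2 ^ s)).

Let N_gt0 s : (0 < ell * 2 ^ s)%N. Proof. by rewrite muln_gt0 ell_gt0 expn_gt0. Qed.
Let v_neq0 s : v (ell * 2 ^ s) != 0. Proof. exact: m_aperiodic. Qed.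
Let v_even s : dvd2 1 (v (ell * 2 ^ s)). Proof. by rewrite ellP dvdn_mulr. Qed.

Lemma eis_depth_gt0 s : (0 < eis_depth s)%N.
Proof. by rewrite /eis_depth -dvd2_ord. Qed.

Let double s : let z := 2 * u (ell * 2 ^ s) - v (ell * 2 ^ s) in
  [/\ z != 0, eis_depth s.+1 = (eis_depth s + ord2 z)%N & dvd2 1 z].
Proof.
set z := (X in let z := X in _); have e : v (ell * 2 ^ s.+1) = v (ell * 2 ^ s) * z.
  by rewrite expnSr mulnA v2n.
have z0 : z != 0.
  by apply: contraNneq (v_neq0 s.+1) => z0; rewrite e z0 mulr0.
split=> //; first by rewrite /eis_depth e ord2M.
by rewrite /z dvd2B// dvd2_2M dvd2_0l.
Qed.

Lemma eis_depth_lt s : (eis_depth s < eis_depth s.+1)%N.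
Proof.
have [z0 -> z1] := double s; rewrite -[X in (X < _)%N]addn0 ltn_add2l.
by rewrite -(dvd2_ord _ z0).
Qed.

(** The factor gained by doubling is [2 u - v]. From index 1 on, 4 divides [v] while [u] is odd, so
    this factor has order exactly 1. *)
Lemma eis_depthSS s : eis_depth s.+2 = (eis_depth s.+1).+1.
Proof.
have [z0 -> z1] := double s.+1; rewrite -[RHS]addn1; congr (_ + _)%N.
apply/eqP; rewrite eqn_leq -(dvd2_ord _ z0) z1 andbT leqNgt -(dvd2_ord _ z0).
have vN : dvd2 2 (v (ell * 2 ^ s.+1)).
  rewrite dvd2_ord//; apply: leq_trans (eis_depth_lt s).
  by rewrite ltnS eis_depth_gt0.
rewrite dvd2DSE ?dvd2N// ?dvd2_2M ?dvd2_0l// vN.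
by rewrite (negbTE (u_odd (v_even _))).
Qed.

Let v_mul n q : exists z, v (n * q) = v n * z.
Proof.
elim: q => [|q [z zE]]; first by exists 0; rewrite muln0 mulr0.
by exists (u n * z + (u (n * q) - v (n * q))); rewrite mulnS vD {1}zE; ring.
Qed.

Lemma eis_depthP s n : dvd2 (eis_depth s) (v n) = (ell * 2 ^ s %| n)%N.
Proof.
apply/idP/idP => [|/dvdnP[q ->]]; last first.
  by rewrite mulnC; have [z ->] := v_mul (ell * 2 ^ s) q; rewrite dvd2Ml// dvd2_ord.
elim: s n => [|s IH] n h.
  by rewrite muln1 -ellP; apply: dvd2_le h; exact: eis_depth_gt0.
have /dvdnP[q nE] := IH n (dvd2_le (ltnW (eis_depth_lt s)) h).
rewrite nE expnSr mulnA [(q * _)%N]mulnC dvdn_pmul2l// dvdn2.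
(* If [q] is odd, [n] is [ell * 2^s] plus a multiple [b] of [ell * 2^(s+1)]. Removing [b] would make
   [v (ell * 2^s)] divisible beyond its order. *)
apply/negP => oq; set b := (ell * 2 ^ s.+1 * q./2)%N.
have nb : n = (ell * 2 ^ s + b)%N.
  rewrite nE -[in LHS](odd_double_half q) oq /b expnSr /= -mul2n add1n mulSn.
  by congr addn; ring.
have vb : dvd2 (eis_depth s.+1) (v b).
  by rewrite /b; have [z ->] := v_mul (ell * 2 ^ s.+1) q./2; rewrite dvd2Ml// dvd2_ord.
have ub : ~~ dvd2 1 (u b - v b).
  have vb1 := dvd2_le (eis_depth_gt0 _) vb.
  by rewrite dvd2_1D dvd2N vb1 (negbTE (u_odd vb1)).
have : dvd2 (eis_depth s.+1) ((u b - v b) * v (ell * 2 ^ s)).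
  have -> : (u b - v b) * v (ell * 2 ^ s) = v n - u (ell * 2 ^ s) * v b.
    by rewrite nb vD; ring.
  by rewrite dvd2B// dvd2Mr.
by rewrite dvd2_oddMl// dvd2_ord// leqNgt eis_depth_lt.
Qed.

End EisensteinOrder.

(** * The multiplier in the unramified quadratic extension *)

Section Embedding.
Variables (R : realFieldType) (K : fieldType) (w : absolute_value R K).
Variables (i : {rmorphism Z2 -> K}) (s : K).
Hypothesis s2 : s ^+ 2 = - 3.
Hypothesis wi : forall t, w (i t) = absZ2 R t.

(** A primitive cube root of unity; its conjugate is [- 1 - om]. *)
Let om : K := (s - 1) / 2.

Definition eis_emb (p : Z2 * Z2) : K := i p.1 + i p.2 * om.
Definition eis_conj (p : Z2 * Z2) : K := i p.1 + i p.2 * (- 1 - om).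

Let two_neq0 : 2 != 0 :> K.
Proof. by rewrite -(absval_eq0 w) -(rmorph_nat i 2) wi absZ2_eq0 Z2_2_neq0. Qed.

Let om2 : om ^+ 2 = - 1 - om.
Proof.
have -> : om ^+ 2 = (s ^+ 2 - 2 * s + 1) / 2 / 2 by rewrite /om; field.
by rewrite s2 /om; field.
Qed.

Let om_s : om - (- 1 - om) = s. Proof. by rewrite /om; field. Qed.

Lemma eis_embM p q : eis_emb (eisM p q) = eis_emb p * eis_emb q.
Proof.
rewrite /eis_emb /eisM /= rmorphB rmorphB rmorphD !rmorphM /=.
by ring: om2.
Qed.

Lemma eis_conjM p q : eis_conj (eisM p q) = eis_conj p * eis_conj q.
Proof.
rewrite /eis_conj /eisM /= rmorphB rmorphB rmorphD !rmorphM /=.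
by ring: om2.
Qed.

Lemma eis_emb_conj p : eis_emb p * eis_conj p = i (eis_norm p).
Proof.
rewrite /eis_conj /eis_emb /eis_norm rmorphD rmorphB !rmorphXn rmorphM /=.
by ring: om2.
Qed.

Let om_le1 : w om <= 1 /\ w (- 1 - om) <= 1.
Proof.
have le1 : w om <= 1.
  have om3 : om ^+ 3 = 1 by rewrite exprS om2 -[RHS]/(1 : K); ring: om2.
  rewrite leNgt; apply/negP => om1; have := congr1 w om3.
  rewrite exprS expr2 (absvalM w om) (absvalM w om) absval1 => /eqP; rewrite gt_eqF//.
  exact: (mulr_egt1 om1 (mulr_egt1 om1 om1)).
by split=> //; rewrite -om2 expr2 (absvalM w om) mulr_ile1 ?absval_ge0.
Qed.

Let emb_le1 z p : w z <= 1 -> w (i p.1 + i p.2 * z) <= 1.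
Proof.
have i1 t : w (i t) <= 1.
  by have := absZ2_le_exp R 0 t; rewrite wi expr0 invr1 dvd2_0l => ->.
move=> z1; apply: le_trans (absval_ultra _ _ _) _.
by rewrite ge_max i1 absvalM mulr_ile1 ?absval_ge0.
Qed.

(** Both conjugates are integral and their product, the norm, is a unit. *)
Lemma absval_eis p : primitive p -> w (eis_emb p) = 1 /\ w (eis_conj p) = 1.
Proof.
move=> pp; have e1 : w (eis_emb p) <= 1 by apply: emb_le1; case: om_le1.
have c1 : w (eis_conj p) <= 1 by apply: emb_le1; case: om_le1.
have : w (eis_emb p) * w (eis_conj p) = 1.
  by rewrite -absvalM eis_emb_conj wi absZ2_odd// eis_norm_odd.
move: (absval_ge0 w (eis_emb p)) (absval_ge0 w (eis_conj p)) e1 c1.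
move: (w _) (w _) => x y x0 y0 x1 y1 xy.
by split; apply/eqP; rewrite eq_le ?x1 ?y1 /= -xy; [rewrite ler_piMr | rewrite ler_piMl].
Qed.

(** The difference of the conjugates of [m^n] is its [w]-coordinate times [s], and [s] is a unit
    because 3 is odd. *)
Lemma absval_multiplier m n : primitive m ->
  w ((eis_emb m / eis_conj m) ^+ n - 1) = absZ2 R (eisX m n).2.
Proof.
move=> mp; have X p k : primitive p ->
    eis_emb p ^+ k = eis_emb (eisX p k) /\ eis_conj p ^+ k = eis_conj (eisX p k).
  move=> _; elim: k => [|k [IHe IHc]].
    by rewrite /eis_emb /eis_conj /= rmorph1 rmorph0 !mul0r addr0.
  by rewrite !exprS IHe IHc -eis_embM -eis_conjM.
have [_ cn] := absval_eis (primitive_eisX n mp).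
have [Xe Xc] := X m n mp.
have c0 : eis_conj (eisX m n) != 0 by rewrite -(absval_eq0 w) cn oner_eq0.
rewrite expr_div_n Xe Xc -(divff c0) -mulrBl absvalM absvalV cn invr1 mulr1.
have -> : eis_emb (eisX m n) - eis_conj (eisX m n) = i (eisX m n).2 * s.
  by rewrite /eis_emb /eis_conj -om_s; ring.
suff s1 : w s = 1 by rewrite absvalM s1 mulr1 wi.
apply/eqP; rewrite -(eqrXn2 (n := 2)) ?absval_ge0 ?ler01// expr1n expr2 -absvalM -expr2 s2.
by rewrite absvalN -(rmorph_nat i 3) wi absZ2_odd.
Qed.

End Embedding.

(** * Powers in the residue field and square roots in a quadratic extension *)

Lemma reduction_expr_eq1 (R : realFieldType) (K : fieldType) (w : absolute_value R K) x n :
  w x <= 1 -> (reduction w x ^+ n == 1) = (w (x ^+ n - 1) < 1).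
Proof.
move=> x1; pose r : valuation_ring w := ValuationRing (x1 : x \in vr_pred w).
have -> : reduction w x = \pi_(residue_field w)%qT r.
  rewrite /reduction; congr (\pi%qT); apply/val_inj.
  by rewrite insubdK.
rewrite -rmorphXn -(rmorph1 \pi_(residue_field w)%qT).
rewrite -Quotient.idealrBE.
by rewrite inE rmorphB rmorphXn rmorph1.
Qed.

Lemma Fadjoin_sqrt (F : fieldType) (K : fieldExtType F) (s : K) (e : F) :
  s ^+ 2 = e%:A -> <<1; s>>%VS = fullv ->
  forall x : K, exists u y : F, x = u%:A + y%:A * s.
Proof.
move=> se sfull x; have /Fadjoin_polyP[p p1 ->] : x \in <<1; s>>%VS.
  by rewrite sfull memvf.
pose P (z : K) := exists u y : F, z = u%:A + y%:A * s.
have sP k : P (s ^+ k).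
  elim: k => [|k [u [y e']]].
    by exists 1, 0; rewrite expr0 scale1r scale0r mul0r addr0.
  exists (y * e), u; rewrite exprS e' -!in_algE rmorphM /= -se.
  by ring.
rewrite horner_coef; elim/big_ind: _ => [|z z' [u [y ->]] [u' [y' ->]]|k _].
- by exists 0, 0; rewrite !scale0r mul0r addr0.
- by exists (u + u'), (y + y'); rewrite !scalerDl; ring.
have /vlineP[a ->] := polyOverP p1 k.
have [u [y ->]] := sP k; exists (a * u), (a * y).
by rewrite -!in_algE !rmorphM /=; ring.
Qed.

Lemma sqrt_in_Fadjoin (F : fieldType) (K : fieldExtType F) (s r : K) (e D : F) :
  2 != 0 :> F -> s ^+ 2 = e%:A -> <<1; s>>%VS = fullv -> r ^+ 2 = D%:A ->
  (forall x : F, x ^+ 2 != D) ->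
  exists y : F, [/\ y != 0, r = y%:A * s & D = y ^+ 2 * e].
Proof.
move=> two se sfull rD Dns.
have inj (x z : F) : x%:A = z%:A :> K -> x = z by move=> h; apply: (fmorph_inj (in_alg K)).
have r_notin x : r <> x%:A.
  move=> rx; case/eqP: (Dns x); apply: inj; rewrite -rD rx.
  by rewrite -!in_algE rmorphXn.
have [u [y ry]] := Fadjoin_sqrt se sfull r.
have y0 : y != 0.
  by apply/eqP => y0; apply: (r_notin u); rewrite ry y0 scale0r mul0r addr0.
have [u0|u0] := eqVneq u 0.
  have ry' : r = y%:A * s by rewrite ry u0 scale0r add0r.
  exists y; split=> //; apply: inj; rewrite -rD ry' exprMn se.
  by rewrite -!in_algE rmorphM rmorphXn.
(* Expanding [r^2 = D] with [u] and [y] nonzero would put [s], and then [r], in the base field. *)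
have h : (2 * u * y)%:A * s = (D - u ^+ 2 - y ^+ 2 * e)%:A.
  rewrite !expr2 -!in_algE rmorphB rmorphB !rmorphM rmorph_nat /= -rD ry -se.
  by ring.
have uy0 : 2 * u * y != 0 by rewrite !mulf_neq0.
case: (r_notin (u + y * ((D - u ^+ 2 - y ^+ 2 * e) / (2 * u * y)))).
have uy0' : (2 * u * y)%:A != 0 :> K by rewrite -in_algE fmorph_eq0.
rewrite ry; apply: (mulfI uy0'); rewrite mulrDr mulrCA h.
by rewrite -!in_algE -!rmorphM -!rmorphD; congr (in_alg K _); field;
  rewrite ?two ?u0 ?y0.
Qed.

(** * Moebius maps in the coordinate adapted to their fixed points *)

Section MobiusAlgebra.
Variables (F : fieldType) (a b c d y U V : F).
Hypothesis two_neq0 : 2 != 0 :> F.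
Hypothesis c_neq0 : c != 0.
Hypothesis y_neq0 : y != 0.
Hypothesis disc : (d - a) ^+ 2 + 4 * b * c = y ^+ 2 * - 3.
Hypothesis UV : U = ((a + d) / y + 1) / 2 * V.

Let A := c / y.
Let B := (d - a) / y / 2 + 1 / 2.

Let bE : b = (y ^+ 2 * - 3 - (d - a) ^+ 2) / c / 2 / 2.
Proof. by rewrite -disc; field; rewrite ?two_neq0 ?c_neq0. Qed.

(** In the coordinate [A u + B] the map has, up to scalars, the matrix with rows [(U, -V)] and
    [(V, U - V)] of multiplication by [U + V w]. The pole and infinity are the next two cases. *)
Lemma mobius_coord_finite u P Q : c * u + d != 0 -> P * 1 = Q * (A * u + B) ->
  (U * P - V * Q) * 1 = (U * Q + V * P - V * Q) * (A * ((a * u + b) / (c * u + d)) + B).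
Proof.
move=> cud; rewrite mulr1 => ->; rewrite UV bE /A /B; field.
by rewrite ?two_neq0 ?c_neq0 ?y_neq0 ?cud.
Qed.

Lemma mobius_coord_pole u P Q : c * u + d = 0 -> P * 1 = Q * (A * u + B) ->
  (U * P - V * Q) * 0 = (U * Q + V * P - V * Q) * 1.
Proof.
move=> /eqP; rewrite addrC addr_eq0 => /eqP dE; rewrite mulr1 => ->.
rewrite UV /A /B dE; field.
by rewrite ?two_neq0 ?y_neq0.
Qed.

Lemma mobius_coord_infinity P Q : P * 0 = Q * 1 ->
  (U * P - V * Q) * 1 = (U * Q + V * P - V * Q) * (A * (a / c) + B).
Proof.
rewrite mulr0 mulr1 => <-; rewrite UV /A /B; field.
by rewrite ?two_neq0 ?c_neq0 ?y_neq0.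
Qed.

End MobiusAlgebra.

Section MobiusDynamics.
Variables (a b c d y : Q2) (m : Z2 * Z2) (ell : nat).
Hypothesis c_neq0 : c != 0.
Hypothesis y_neq0 : y != 0.
Hypothesis disc : (d - a) ^+ 2 + 4 * b * c = y ^+ 2 * - 3.
Hypothesis mE : q2 m.1 = ((a + d) / y + 1) / 2 * q2 m.2.
Hypothesis m_primitive : primitive m.
Hypothesis m_aperiodic : forall n, (0 < n)%N -> (eisX m n).2 != 0.
Hypothesis ell_gt0 : (0 < ell)%N.
Hypothesis ellP : forall n, dvd2 1 (eisX m n).2 = (ell %| n)%N.

Let A : Q2 := c / y.
Let B : Q2 := (d - a) / y / 2 + 1 / 2.
Let f := mobius a b c d.

Let A_neq0 : A != 0. Proof. exact: (mulf_neq0 c_neq0 (invr_neq0 y_neq0)). Qed.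

Lemma represents_mobius p x : represents A B p x -> represents A B (eisM m p) (f x).
Proof.
rewrite /represents /f /= q2B q2B q2D !q2M; case: x => [u|] /=.
  case: (altP (c * u + d =P 0)) => cud /= px.
    exact: (mobius_coord_pole Q2_2_neq0 y_neq0 mE cud px).
  exact: (mobius_coord_finite Q2_2_neq0 c_neq0 y_neq0 disc mE cud px).
rewrite (negbTE c_neq0) /= => px.
exact: (mobius_coord_infinity Q2_2_neq0 c_neq0 y_neq0 mE px).
Qed.

Lemma represents_iter p x n : represents A B p x ->
  represents A B (eisM (eisX m n) p) (iter n f x).
Proof.
move=> px; rewrite -iter_eisM; elim: n => // n IH.
exact: represents_mobius.
Qed.

Let pc x := primitive_coord A B x.
Let rc x := represents_coord A B x.

Lemma class_mobius k x z : class A B k (f x) (f z) <-> class A B k x z.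
Proof.
have [px pz] := (represents_mobius (rc x), represents_mobius (rc z)).
have e := classP k (primitive_eisM m_primitive (pc x)) (primitive_eisM m_primitive (pc z)) px pz.
apply: (iff_trans e).
by rewrite cross_eisM dvd2_oddMl ?eis_norm_odd.
Qed.

Lemma class_iter k x n : class A B k x (iter n f x) <-> dvd2 k (eisX m n).2.
Proof.
have px := represents_iter n (rc x).
have pp := primitive_eisM (primitive_eisX n m_primitive) (pc x).
apply: (iff_trans (classP k (pc x) pp (rc x) px)).
by rewrite cross_eisMr dvd2_oddMl ?eis_norm_odd ?pc.
Qed.

Let e := eis_depth m ell.

Let Te s x n : class A B (e s) x (iter n f x) <-> (ell * 2 ^ s %| n)%N.
Proof.
by rewrite -(eis_depthP m_primitive m_aperiodic ell_gt0 ellP); exact: class_iter.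
Qed.

Lemma mobius_decomposition : exists2 M,
  (M * (ell * 2 ^ 1) = 3 * 2 ^ (e 1).-1)%N & decomposed_into_minimal f M.
Proof.
exact: (tower_decomposition (@class_refl A B) (@class_sym A B) (@class_trans A B)
  (@class_le A B) (class_sep A_neq0) (class_nbhs B A_neq0)
  (@one_point_compactification_compact Q2) class_mobius (class_base B A_neq0)
  (class_split B A_neq0) (@class_pigeon A B) ell_gt0
  (eis_depth_gt0 m_aperiodic ell_gt0 ellP)
  (eis_depth_lt m_aperiodic ell_gt0 ellP)
  (eis_depthSS m_primitive m_aperiodic ell_gt0 ellP) Te).
Qed.

Lemma mobius_minimal_odometer E : E !=set0 -> minimal_subsystem f E ->
  topologically_conjugate f E (adding_machine (fun s => ell * 2 ^ s)%N)
    (odometer (fun s => ell * 2 ^ s)%N).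
Proof.
exact: (minimal_odometer (@class_sym A B) (@class_trans A B)
  (@class_le A B) (class_sep A_neq0) (class_nbhs B A_neq0)
  (@one_point_compactification_compact Q2) class_mobius
  (@class_pigeon A B) ell_gt0
  (eis_depth_gt0 m_aperiodic ell_gt0 ellP)
  (eis_depth_lt m_aperiodic ell_gt0 ellP)
  (eis_depthSS m_primitive m_aperiodic ell_gt0 ellP) Te).
Qed.

End MobiusDynamics.

(** * Identification of the multiplier and the final count *)

Lemma eis_multiplierE (K : fieldType) (i : {rmorphism Z2 -> K}) (s S Y : K)
    (m : Z2 * Z2) :
  2 != 0 :> K -> Y != 0 -> i m.2 != 0 -> i m.1 = (S / Y + 1) / 2 * i m.2 ->
  eis_emb i s m / eis_conj i s m = (S + Y * s) / (S - Y * s).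
Proof.
move=> two0 Y0 V0; rewrite /eis_emb /eis_conj => ->; move: (i m.2) V0 => V V0.
have k0 : V / Y / 2 != 0 by rewrite !mulf_neq0 ?invr_neq0.
have -> : (S / Y + 1) / 2 * V + V * ((s - 1) / 2) = V / Y / 2 * (S + Y * s).
  by field; rewrite two0 Y0.
have -> : (S / Y + 1) / 2 * V + V * (- 1 - (s - 1) / 2) = V / Y / 2 * (S - Y * s).
  by field; rewrite two0 Y0.
by rewrite -mulf_div divff// mul1r.
Qed.

Lemma in_alg_slope (F : fieldType) (K : fieldExtType F) (S Y V : F) :
  ((S / Y + 1) / 2 * V)%:A = (S%:A / Y%:A + 1) / 2 * V%:A :> K.
Proof.
by rewrite -!in_algE rmorphM fmorph_div rmorphD fmorph_div rmorph1 rmorph_nat.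
Qed.

Lemma v2_absZ2 (R : realType) (K : fieldType) (w : absolute_value R K) x (t : Z2) :
  t != 0 -> w x = absZ2 R t -> v2 w x = (ord2 t)%:R.
Proof.
move=> t0 wx; have ln2 : ln 2 != 0 :> R by rewrite gt_eqF// ln_gt0// ltr1n.
rewrite /v2 wx /absZ2 (negbTE t0) lnV ?posrE ?exprn_gt0// lnXn//.
by rewrite mulNr opprK -(mulr_natl (ln 2)) mulfK.
Qed.

Theorem theorem5p7 (R : realType) (a b c d : Q2)
    (K : fieldExtType Q2) (absK : absolute_value R K) (sqrtD : K) (ell : nat) :
  let Delta : Q2 := (d - a) ^+ 2 + 4 * b * c in
  let lambda : K := ((a + d)%:A + sqrtD) / ((a + d)%:A - sqrtD) in
  let phi : P1Q2 -> P1Q2 := mobius a b c d in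
  let p : nat -> nat := fun s => (ell * 2 ^ s)%N in
  a * d - b * c != 0 ->
  (* Delta has no square root in Q_2, and K = Q_2(sqrt Delta) *)
  (forall x : Q2, x ^+ 2 != Delta) ->
  sqrtD ^+ 2 = Delta%:A ->
  <<1; sqrtD>>%VS = fullv ->
  (* absK extends the 2-adic absolute value to K *)
  (forall x : Q2, absK x%:A = abs2 R x) ->
  (forall n : nat, (0 < n)%N -> lambda ^+ n != 1) ->
  (* ell is the multiplicative order of lambda in the residue field of K *)
  ell.-primitive_root (reduction absK lambda) ->
  (* K = Q_2(sqrt (-3)) *)
  (exists2 s : K, s ^+ 2 = - 3 & <<1; s>>%VS = fullv) ->
  (exists2 M : nat,
      M%:R = 3 * 2 `^ (v2 absK (lambda ^+ (2 * ell) - 1) - 2) / ell%:R :> R &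
      decomposed_into_minimal phi M) /\
  (forall E : set P1Q2, E !=set0 -> minimal_subsystem phi E ->
     topologically_conjugate phi E (adding_machine p) (odometer p)).
Proof.
move=> Delta lambda phi p _ Dns sD _ absKE lam1 ell_prim [s s2 sfull].
have s2' : s ^+ 2 = (- 3)%:A by rewrite s2 -in_algE rmorphN rmorph_nat.
have [y [y0 sDE DE]] := sqrt_in_Fadjoin Q2_2_neq0 s2' sfull sD Dns.
(* For [c = 0] the discriminant would be the square of [d - a]. *)
have c0 : c != 0.
  by apply/eqP => c0; case/eqP: (Dns (d - a)); rewrite /Delta c0 mulr0 addr0.
(* With this slope [m] is a scalar multiple of [a + d + y s], hence [lambda] is [m] over its
   conjugate. *)
have [m [mp m2 mE]] := Q2_primitive (((a + d) / y + 1) / 2).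
pose i : {rmorphism Z2 -> K} := (in_alg K \o @tofrac Z2)%FUN.
have iE t : i t = (q2 t)%:A by rewrite /q2 -lock.
have wi t : absK (i t) = absZ2 R t by rewrite iE absKE abs2_q2.
have inj0 (x : Q2) : x != 0 -> x%:A != 0 :> K by rewrite -in_algE fmorph_eq0.
have lamE : lambda = eis_emb i s m / eis_conj i s m.
  rewrite /lambda sDE; apply/esym/eis_multiplierE.
  - by rewrite -(rmorph_nat (in_alg K)) fmorph_eq0 Q2_2_neq0.
  - exact: (inj0 y y0).
  - by rewrite iE; apply: inj0; rewrite q2_eq0.
  - by rewrite !iE mE; exact: (in_alg_slope K (a + d) y (q2 m.2)).
have lamX n : absK (lambda ^+ n - 1) = absZ2 R (eisX m n).2.
  by rewrite lamE; exact: absval_multiplier.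
have aper n : (0 < n)%N -> (eisX m n).2 != 0.
  by move=> /lam1; rewrite -(absZ2_eq0 R) -lamX absval_eq0 subr_eq0.
have lam_le1 : absK lambda <= 1.
  have [e1 c1] := absval_eis s2 wi mp.
  by rewrite lamE absvalM absvalV e1 c1 invr1 mulr1.
have ell0 := prim_order_gt0 ell_prim.
have ellP n : dvd2 1 (eisX m n).2 = (ell %| n)%N.
  by rewrite (prim_order_dvd ell_prim) reduction_expr_eq1// lamX absZ2_lt1.
split; last exact: (mobius_minimal_odometer c0 y0 DE mE mp aper ell0 ellP).
have [M ME dM] := mobius_decomposition c0 y0 DE mE mp aper ell0 ellP.
exists M; last exact: dM.
(* The exponent is at least 2, so subtracting 2 in the natural numbers agrees with the real
   exponent. *)
have e2 : (1 < eis_depth m ell 1)%N.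
  apply: leq_trans (eis_depth_lt aper ell0 ellP 0).
  by rewrite ltnS (eis_depth_gt0 aper ell0 ellP).
have N0 : (0 < ell * 2 ^ 1)%N by rewrite muln_gt0 ell0.
rewrite [(2 * ell)%N]mulnC (v2_absZ2 (aper _ N0) (lamX _)) -/(eis_depth m ell 1).
move: e2 ME; case: (eis_depth m ell 1) => [|[|k]]// _ ME.
rewrite -natrB// powR_mulrn// subn2 /=.
have ellR : ell%:R != 0 :> R by rewrite pnatr_eq0 -lt0n.
apply: (mulIf ellR); rewrite divfK// -natrX -natrM -natrM; congr (_%:R).
(* The period [2 ell] contributes the second factor 2 removed from [2^(e 1)]. *)
by apply/eqP; rewrite -(eqn_pmul2r (_ : 0 < 2)%N)// -mulnA ME /= expnSr mulnA.
Qed.
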